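(* Let $M$ be a connected sRC-manifold, complete with respect to its sub-Riemannian distance, and let $\mathscr{K}$ be the Lie algebra of its $H$-Killing fields. If $HM$ has rank $k$ and $VM$ has rank $m$, then $$\dim\mathscr{K}\le m+k+\frac{k(k-1)}{2}=m+\frac{k(k+1)}{2}.$$
   Context: A sub-Riemannian manifold is a smooth manifold $M$ with a smooth bracket-generating subbundle $HM\subseteq TM$ and a smooth inner product $\langle\cdot,\cdot\rangle$ on $HM$. An sRC-manifold is a sub-Riemannian manifold together with a smooth subbundle $VM$ such that $TM=HM\oplus VM$. A smooth vector field $K$ is an $H$-Killing field if $[K,HM]\subset HM$, $[K,VM]\subset VM$ (brackets with sections), and $K\langle X,Y\rangle=\langle[K,X],Y\rangle+\langle X,[K,Y]\rangle$ for all sections $X,Y$ of $HM$. *)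

(* Defs.v *)
From HB Require Import structures.
From mathcomp Require Import all_boot all_order all_algebra.
From mathcomp Require Import all_classical all_reals all_analysis.
Set Implicit Arguments.
Unset Strict Implicit.
Unset Printing Implicit Defensive.
Import Order.TTheory GRing.Theory Num.Theory.
Import numFieldNormedType.Exports.
Local Open Scope classical_set_scope.
Local Open Scope ring_scope.

(** * Bases and dimension in a possibly infinite-dimensional vector space *)

Definition is_basis (R : realType) (V : lmodType R) (P : set V) (d : nat)
    (e : 'I_d -> V) : Prop :=
  (forall c : 'I_d -> R, \sum_i c i *: e i = 0 -> forall i, c i = 0) /\
  P = [set v | exists c : 'I_d -> R, v = \sum_i c i *: e i].

(* In particular [P] is a linear subspace of [V]. *)
Definition has_dim (R : realType) (V : lmodType R) (P : set V) (d : nat) : Prop :=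
  exists e : 'I_d -> V, is_basis P e.

(** * Smooth functions on open subsets of R^n *)

Definition pderiv (R : realType) (n : nat) (i : 'I_n) (f : 'rV[R]_n -> R) :
    'rV[R]_n -> R :=
  fun x => 'D_(delta_mx 0 i) f x.

Fixpoint Ck (R : realType) (n r : nat) (U : set 'rV[R]_n) (f : 'rV[R]_n -> R) :
    Prop :=
  {in U, continuous f} /\
  (if r is r'.+1 then
     forall i : 'I_n,
       (forall x, U x -> derivable f x (delta_mx 0 i)) /\ Ck r' U (pderiv i f)
   else True).

Definition smooth_on (R : realType) (n : nat) (U : set 'rV[R]_n)
    (f : 'rV[R]_n -> R) : Prop := forall r, Ck r U f.

Section Ck_theory.
Context (R : realType) (n : nat) (U : set 'rV[R]_n).
Hypothesis oU : open U.
Implicit Types f g : 'rV[R]_n -> R.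

Let nearU (P : 'rV[R]_n -> Prop) (x : 'rV[R]_n) :
  (forall y, U y -> P y) -> U x -> \forall y \near x, P y.
Proof.
by move=> UP Ux; apply: filterS (open_nbhs_nbhs (conj oU Ux)) => y /UP.
Qed.

Let delta_neq0 (i : 'I_n) : (delta_mx 0 i : 'rV[R]_n) != 0.
Proof.
apply/negP => /eqP/rowP/(_ i); rewrite !mxE !eqxx => /eqP.
by rewrite oner_eq0.
Qed.

Lemma Ck_ext r f g : (forall x, U x -> f x = g x) -> Ck r U f -> Ck r U g.
Proof.
have cext f' g' : (forall x, U x -> f' x = g' x) ->
    {in U, continuous f'} -> {in U, continuous g'}.
  move=> fg cf x xU; have Ux := set_mem xU.
  rewrite /continuous_at -fg//; apply: cvg_trans (cf x xU).
  apply: near_eq_cvg; first exact: nbhs_filter.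
  by apply: (nearU (P := fun y => f' y = g' y)) Ux => y Uy; exact: fg.
elim: r f g => [|r IH] f g fg /= [cf df]; split => //; do ?exact: cext cf.
have nfg x : U x -> {near x, f =1 g}.
  by move=> Ux; apply: (nearU (P := fun y => f y = g y)) Ux => y Uy; exact: fg.
move=> i; have [di Ci] := df i; split.
  by move=> x Ux; apply: near_eq_derivable (di x Ux) => //; exact: nfg.
apply: IH Ci => x Ux; apply: near_eq_derive => //; exact: nfg.
Qed.

Lemma CkS r f : Ck r.+1 U f -> Ck r U f.
Proof.
elim: r f => [|r IH] f [cf df]; split => // i; have [di Ci] := df i.
by split => //; exact: IH.
Qed.

Lemma Ck_cst r (a : R) : Ck r U (cst a).
Proof.
have cc (b : R) : {in U, continuous (cst b : 'rV[R]_n -> R)}.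
  by move=> x _; exact: cst_continuous.
elim: r a => [|r IH] a /=; split => // i.
split; first by move=> x _; exact: derivable_cst.
apply: (@Ck_ext _ (cst 0)) => // x _.
by rewrite /pderiv derive_cst.
Qed.

Lemma CkD r f g : Ck r U f -> Ck r U g -> Ck r U (f + g).
Proof.
elim: r f g => [|r IH] f g /= [cf df] [cg dg];
  (split; first by move=> x xU; apply: continuousD; [exact: cf|exact: cg]) => // i.
have [dfi Cfi] := df i; have [dgi Cgi] := dg i; split.
  by move=> x Ux; apply: derivableD; [exact: dfi|exact: dgi].
apply: Ck_ext (IH _ _ Cfi Cgi) => x Ux.
by rewrite /pderiv deriveD//; [exact: dfi|exact: dgi].
Qed.

Lemma CkM r f g : Ck r U f -> Ck r U g -> Ck r U (f * g).
Proof.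
elim: r f g => [|r IH] f g Cf Cg; move: (Cf) (Cg) => /= [cf df] [cg dg];
  (split; first by move=> x xU; apply: continuousM; [exact: cf|exact: cg]) => // i.
have [dfi Cfi] := df i; have [dgi Cgi] := dg i; split.
  by move=> x Ux; apply: derivableM; [exact: dfi|exact: dgi].
apply: Ck_ext (CkD (IH _ _ (CkS Cf) Cgi) (IH _ _ (CkS Cg) Cfi)) => x Ux.
by rewrite /pderiv deriveM//; [exact: dfi|exact: dgi].
Qed.

End Ck_theory.

(** * Smooth manifolds *)

Record chart (R : realType) (n : nat) (M : topologicalType) := Chart {
  cdom : set M;
  cimg : set 'rV[R]_n;
  cmap : M -> 'rV[R]_n;
  cinv : 'rV[R]_n -> M;
  cdom_open : open cdom;
  cimg_open : open cimg;
  cmap_img : forall p, cdom p -> cimg (cmap p);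
  cinv_dom : forall x, cimg x -> cdom (cinv x);
  cmapK : forall p, cdom p -> cinv (cmap p) = p;
  cinvK : forall x, cimg x -> cmap (cinv x) = x;
  cmap_continuous : {in cdom, continuous cmap};
  cinv_continuous : {in cimg, continuous cinv}
}.

Definition smooth_transition (R : realType) (n : nat) (M : topologicalType)
    (c1 c2 : chart R n M) : Prop :=
  forall j : 'I_n,
    smooth_on (cimg c1 `&` cinv c1 @^-1` cdom c2)
      (fun x => cmap c2 (cinv c1 x) 0 j).

(* The atlas need not be maximal: every smooth atlas determines the smooth
   structure. *)
Record manifold (R : realType) (n : nat) := Manifold {
  carrier :> topologicalType;
  atlas : set (chart R n carrier);
  manifold_hausdorff : hausdorff_space carrier;
  manifold_second_countable : @second_countable carrier;
  atlas_cover : forall p : carrier, exists2 c, atlas c & cdom c p;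
  atlas_smooth :
    forall c1 c2, atlas c1 -> atlas c2 -> smooth_transition c1 c2
}.

Definition smooth (R : realType) (n : nat) (M : manifold R n) (f : M -> R) : Prop :=
  forall c, atlas c -> smooth_on (cimg c) (f \o cinv c).

Definition smooth_pred (R : realType) (n : nat) (M : manifold R n) :
  {pred M -> R} := fun f => `[< smooth f >].

Record cinfty (R : realType) (n : nat) (M : manifold R n) := CInfty {
  cinfty_fun :> M -> R;
  cinftyP : cinfty_fun \in @smooth_pred R n M
}.

Section cinfty_algebra.
Context (R : realType) (n : nat) (M : manifold R n).

Lemma smooth_subring_closed : subring_closed (@smooth_pred R n M).
Proof.
have smoothM f g : smooth f -> smooth g -> smooth (f * g : M -> R).
  move=> sf sg c ca r.
  exact: (Ck_ext (cimg_open (c := c)) _ (CkM (cimg_open (c := c)) (sf c ca r) (sg c ca r))).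
have smooth_cst (a : R) : smooth (cst a : M -> R).
  by move=> c ca r; exact: (Ck_cst (cimg_open (c := c))).
split=> [|f g|f g]; rewrite !unfold_in.
- by apply/asboolP; exact: (smooth_cst 1).
- move=> /asboolP sf /asboolP sg; apply/asboolP => c ca r.
  have sNg := smoothM _ _ (smooth_cst (-1)) sg.
  apply: (Ck_ext (cimg_open (c := c)) _
    (CkD (cimg_open (c := c)) (sf c ca r) (sNg c ca r))) => x _.
  by rewrite /= !fctE mulN1r.
- by move=> /asboolP sf /asboolP sg; apply/asboolP; exact: smoothM.
Qed.

Lemma smooth_scaler_closed : scaler_closed (@smooth_pred R n M).
Proof.
move=> a f; rewrite !unfold_in => /asboolP sf; apply/asboolP => c ca r.
exact: (Ck_ext (cimg_open (c := c)) _
  (CkM (cimg_open (c := c)) (Ck_cst (cimg_open (c := c)) r a) (sf c ca r))).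
Qed.

HB.instance Definition _ := [isSub for @cinfty_fun R n M].
HB.instance Definition _ := [Choice of cinfty M by <:].
HB.instance Definition _ :=
  GRing.isSubringClosed.Build _ (@smooth_pred R n M) smooth_subring_closed.
HB.instance Definition _ :=
  GRing.isScaleClosed.Build _ _ (@smooth_pred R n M) smooth_scaler_closed.
HB.instance Definition _ :=
  GRing.SubChoice_isSubComPzRing.Build (M -> R) (@smooth_pred R n M) (cinfty M)
    smooth_subring_closed.
HB.instance Definition _ := [SubZmodule_isSubLmodule of cinfty M by <:].

End cinfty_algebra.

(** * Tangent vectors and vector fields, as derivations *)

Definition tangent (R : realType) (n : nat) (M : manifold R n) (p : M)
    (v : cinfty M -> R) : Prop :=
  (forall (a : R) (f g : cinfty M), v (a *: f + g) = a * v f + v g) /\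
  (forall f g : cinfty M, v (f * g) = f p * v g + g p * v f).

Definition vector_field (R : realType) (n : nat) (M : manifold R n)
    (X : cinfty M -> cinfty M) : Prop :=
  (forall (a : R) (f g : cinfty M), X (a *: f + g) = a *: X f + X g) /\
  (forall f g : cinfty M, X (f * g) = f * X g + g * X f).

Definition value_at (R : realType) (n : nat) (M : manifold R n)
    (X : cinfty M -> cinfty M) (p : M) : cinfty M -> R :=
  fun f => X f p.

Definition bracket (R : realType) (n : nat) (M : manifold R n)
    (X Y : cinfty M -> cinfty M) : cinfty M -> cinfty M :=
  fun f => X (Y f) - Y (X f).

Definition section (R : realType) (n : nat) (M : manifold R n)
    (D : M -> set (cinfty M -> R)) (X : cinfty M -> cinfty M) : Prop :=
  vector_field X /\ forall p, D p (value_at X p).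

(* The local frames are restrictions of globally defined vector fields, which
   are only required to lie in [D] near the given point. *)
Definition subbundle (R : realType) (n : nat) (M : manifold R n) (r : nat)
    (D : M -> set (cinfty M -> R)) : Prop :=
  forall p : M, exists X : 'I_r -> (cinfty M -> cinfty M),
    (forall i, vector_field (X i)) /\
    \forall q \near p, is_basis (D q) (fun i => value_at (X i) q).

(** * Sub-Riemannian and sRC-manifolds *)

Inductive iterated_bracket (R : realType) (n : nat) (M : manifold R n)
    (D : M -> set (cinfty M -> R)) : (cinfty M -> cinfty M) -> Prop :=
| iterated_section X : section D X -> iterated_bracket D X
| iterated_step X Y : iterated_bracket D X -> iterated_bracket D Y ->
    iterated_bracket D (bracket X Y).

Definition bracket_generating (R : realType) (n : nat) (M : manifold R n)
    (D : M -> set (cinfty M -> R)) : Prop :=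
  forall (p : M) (v : cinfty M -> R), tangent p v ->
    exists (d : nat) (c : 'I_d -> R) (X : 'I_d -> (cinfty M -> cinfty M)),
      (forall i, iterated_bracket D (X i)) /\
      v = \sum_i c i *: value_at (X i) p.

(* [metric p] is only meaningful on [horizontal p]. *)
Record sub_riemannian (R : realType) (n k : nat) (M : manifold R n) :=
    SubRiemannian {
  horizontal : M -> set (cinfty M -> R);
  metric : M -> (cinfty M -> R) -> (cinfty M -> R) -> R;
  horizontal_subbundle : subbundle k horizontal;
  horizontal_bracket_generating : bracket_generating horizontal;
  metric_linear : forall p (a : R) u v w,
    horizontal p u -> horizontal p v -> horizontal p w ->
    metric p (a *: u + v) w = a * metric p u w + metric p v w;
  metric_sym : forall p u v,
    horizontal p u -> horizontal p v -> metric p u v = metric p v u;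
  metric_pos : forall p u, horizontal p u -> u != 0 -> 0 < metric p u u;
  metric_smooth : forall X Y, section horizontal X -> section horizontal Y ->
    smooth (fun p => metric p (value_at X p) (value_at Y p))
}.

Record sRC_structure (R : realType) (n k m : nat) (M : manifold R n) :=
    SRCStructure {
  sub_riemannian_of :> sub_riemannian k M;
  vertical : M -> set (cinfty M -> R);
  vertical_subbundle : subbundle m vertical;
  tangent_direct_sum : forall (p : M) (v : cinfty M -> R), tangent p v ->
    exists! hw : (cinfty M -> R) * (cinfty M -> R),
      [/\ horizontal sub_riemannian_of p hw.1, vertical p hw.2 & v = hw.1 + hw.2]
}.

(** * Sub-Riemannian distance and completeness *)

(* A map into [M] is smooth iff its compositions with all smooth functions on
   [M] are. A smooth curve on a compact interval is the restriction of one
   defined on the whole line. *)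
Definition smooth_curve (R : realType) (n : nat) (M : manifold R n)
    (gamma : R -> M) : Prop :=
  forall (f : cinfty M) (j : nat) (t : R),
    derivable (derive1n j (f \o gamma)) t 1.

Definition velocity (R : realType) (n : nat) (M : manifold R n)
    (gamma : R -> M) (t : R) : cinfty M -> R :=
  fun f => derive1 (f \o gamma) t.

Definition horizontal_curve (R : realType) (n k : nat) (M : manifold R n)
    (S : sub_riemannian k M) (gamma : R -> M) : Prop :=
  smooth_curve gamma /\
  forall t, 0 <= t <= 1 -> horizontal S (gamma t) (velocity gamma t).

Definition curve_length (R : realType) (n k : nat) (M : manifold R n)
    (S : sub_riemannian k M) (gamma : R -> M) : \bar R :=
  (\int[lebesgue_measure]_(t in `[0%R, 1%R])
    (Num.sqrt (metric S (gamma t) (velocity gamma t) (velocity gamma t)))%:E)%E.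

(* [horizontal_path S p q l]: some piecewise smooth horizontal curve of length
   [l] goes from [p] to [q]. Each smooth piece is parametrized by [0, 1]. *)
Inductive horizontal_path (R : realType) (n k : nat) (M : manifold R n)
    (S : sub_riemannian k M) : M -> M -> \bar R -> Prop :=
| path_nil p : horizontal_path S p p 0%E
| path_cons gamma q l : horizontal_curve S gamma ->
    horizontal_path S (gamma 1) q l ->
    horizontal_path S (gamma 0) q (curve_length S gamma + l)%E.

Definition sr_dist (R : realType) (n k : nat) (M : manifold R n)
    (S : sub_riemannian k M) (p q : M) : \bar R :=
  ereal_inf [set l | horizontal_path S p q l].

Definition sr_complete (R : realType) (n k : nat) (M : manifold R n)
    (S : sub_riemannian k M) : Prop :=
  forall u : nat -> M,
    (forall e : R, 0 < e -> exists N, forall i j, (N <= i)%N -> (N <= j)%N ->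
      (sr_dist S (u i) (u j) < e%:E)%E) ->
    exists p : M, forall e : R, 0 < e -> exists N, forall i, (N <= i)%N ->
      (sr_dist S (u i) p < e%:E)%E.

(** * H-Killing fields *)

Definition inner (R : realType) (n k : nat) (M : manifold R n)
    (S : sub_riemannian k M) (X Y : cinfty M -> cinfty M) : M -> R :=
  fun p => metric S p (value_at X p) (value_at Y p).

(* [h] is the function [inner S X Y], regarded as an element of [cinfty M]; it
   exists by [metric_smooth]. *)
Definition H_Killing (R : realType) (n k m : nat) (M : manifold R n)
    (S : sRC_structure k m M) : set (cinfty M -> cinfty M) :=
  [set K | [/\ vector_field K,
    forall X, section (horizontal S) X -> section (horizontal S) (bracket K X),
    forall X, section (vertical S) X -> section (vertical S) (bracket K X) &
    forall X Y (h : cinfty M),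
      section (horizontal S) X -> section (horizontal S) Y ->
      h =1 inner S X Y ->
      K h =1 (fun p => inner S (bracket K X) Y p + inner S X (bracket K Y) p)]].

(* Main.v *)
Require Import Defs.
From HB Require Import structures.
From mathcomp Require Import all_boot all_order all_algebra.
From mathcomp Require Import all_classical all_reals all_analysis.
From mathcomp Require Import ring lra zify.
Set Implicit Arguments.
Unset Strict Implicit.
Unset Printing Implicit Defensive.
Import Order.TTheory GRing.Theory Num.Theory.
Import numFieldNormedType.Exports.
Local Open Scope classical_set_scope.
Local Open Scope ring_scope.

(* A Killing field K is determined by K_p and the skew endomorphism X |-> [K, X]_p
   of H_p, at any point p; this gives the bound (k + m) + k(k - 1)/2.

   Near p, let J be the ideal generated by the functions K f and [K, X] f with X
   horizontal. For X horizontal, X(K f) = K(X f) - [K, X] f lies in J, and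
   modulo J the component along H of [X, [K, Y]] is the derivative of [K, Y] along
   X. It is symmetric in X, Y: [X, [K, Y]] - [Y, [K, X]] = [K, [X, Y]] is vertical
   modulo J, since K preserves V. Paired with Z it is skew in Y, Z, since K
   preserves the metric. Hence it vanishes modulo J: horizontal fields, and so their
   iterated brackets, preserve J. As these span the tangent spaces, the generators
   of J satisfy a linear first-order system in coordinates; if they vanish at p,
   they vanish near p, and K = 0 by connectedness. *)

(** * A smooth function that is flat at the origin *)

(** Tangent vectors and vector fields are derivations of the algebra of global smooth functions, so
    nothing is local by definition. Cutoff functions supply locality, and a germ at [p] is handled
    through global representatives. In the geometric argument, [k + m] functions [f], dual at [p] to
    a frame adapted to H and V, play the role of coordinates: a matrix [B] inverting E_a(f_c) near
    [p] gives frame components as global functions. Partial derivatives in a chart return only in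
    the final linear system.

    The equations for K and [K, X] control horizontal derivatives only, while the linear system
    needs all directions. Passing to an ideal removes this obstacle, because stability under X and Y
    gives stability under [X, Y] at no cost. Finitely many generators suffice, since a vector field
    is determined near [p] by its values on [f]; hence the system has finitely many unknowns and an
    energy estimate applies. *)

Section line.
Context (R : realType) (n : nat).
Implicit Types (f : 'rV[R]_n -> R) (x v : 'rV[R]_n).

(** The two difference quotients agree term by term. One-variable calculus thereby serves for
    partial derivatives, both in the chain rule and in the uniqueness argument along coordinate
    axes. *)
Lemma is_derive_lineP f x v (t a : R) :
  is_derive (x + t *: v) v f a <-> is_derive t 1 (fun s : R => f (x + s *: v)) a.
Proof.
suff e : (fun h : R => h^-1 *: ((f \o shift (x + t *: v)) (h *: v) - f (x + t *: v)))
       = (fun h : R => h^-1 *: (((fun s : R => f (x + s *: v)) \o shift t) (h *: 1)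
            - f (x + t *: v))).
  by split => -[d <-]; split; rewrite /derivable /derive ?e // /derivable /derive -?e.
apply/funext => h /=; rewrite /shift/= addrCA -scalerDl.
by rewrite [h%:A]mulr1.
Qed.

Lemma is_derive_comp1 (g : R -> R) f x v (a b : R) :
  is_derive x v f b -> is_derive (f x) 1 g a -> is_derive x v (g \o f) (a * b).
Proof.
move=> fb ga.
have -> : x = x + (0 : R) *: v by rewrite scale0r addr0.
apply/is_derive_lineP; apply: (@is_derive1_comp _ g (fun s : R => f (x + s *: v))).
  by rewrite scale0r addr0.
by apply/is_derive_lineP; rewrite scale0r addr0.
Qed.
End line.

Section flat.
Context (R : realType).

(** For [j = 0] this is the classical exp(-1/t). The powers of 1/t are included because derivatives
    of members of the family are combinations of members of the family. *)
Definition flat (j : nat) (t : R) : R :=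
  if 0 < t then t^-1 ^+ j * expR (- t^-1) else 0.

Lemma flat_ge0 j t : 0 <= flat j t.
Proof.
by rewrite /flat; case: ifP => // t0; rewrite mulr_ge0 ?expR_ge0 ?exprn_ge0 ?invr_ge0 ?ltW.
Qed.

Lemma flat0_gt0 t : 0 < t -> 0 < flat 0 t.
Proof. by move=> t0; rewrite /flat t0 mul1r expR_gt0. Qed.

Lemma flat_le0 j t : t <= 0 -> flat j t = 0.
Proof. by move=> t0; rewrite /flat ltNge t0. Qed.

Lemma flatS j t : flat j t = flat j.+1 t * t.
Proof.
rewrite /flat; case: ifPn => [t0|]; last by rewrite mul0r.
by rewrite exprSr -!mulrA [_^-1 * _]mulrC -!mulrA mulfV ?mulr1 ?gt_eqF.
Qed.

(** The exponential series at 1/t dominates its term of degree j + 1; the factorial comes from that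
    term. *)
Lemma flat_le j t : 0 <= t -> flat j t <= (j.+1)`!%:R * t.
Proof.
move=> t0; rewrite /flat; case: ifPn => [{}t0|]; last by rewrite mulr_ge0.
have s0 : 0 < t^-1 by rewrite invr_gt0.
have := expR_ge1Dxn j (ltW s0).
have F : 0 < (j.+1)`!%:R :> R by rewrite ltr0n fact_gt0.
set F' := _%:R in F *; set e := expR t^-1 => He.
have e0 : 0 < e by exact: expR_gt0.
rewrite expRN -/e ler_pdivrMr//.
have : t^-1 ^+ j.+1 / F' <= e by apply: le_trans He; rewrite lerDr.
rewrite ler_pdivrMr// exprSr -ler_pdivlMr ?invr_gt0// invrK.
by move=> /le_trans; apply; rewrite [e * _]mulrC -mulrA [e * _]mulrC mulrA.
Qed.

Lemma flat_continuous0 j : {for 0, continuous (flat j)}.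
Proof.
have -> : {for 0, continuous (flat j)} = (flat j t @[t --> 0] --> (0 : R)).
  by rewrite /prop_for /continuous_at flat_le0.
apply: (@squeeze_cvgr _ _ _ _ (cst 0) (fun t => (j.+1)`!%:R * `|t|)).
- near=> t; rewrite flat_ge0/=; have [t0|t0] := leP 0 t.
    by rewrite (ger0_norm t0) flat_le.
  by rewrite flat_le0 ?mulr_ge0// ltW.
- exact: cvg_cst.
- rewrite -[X in _ --> X](mulr0 (j.+1)`!%:R); apply: cvgM; first exact: cvg_cst.
  by rewrite -[X in _ --> X](@normr0 R R); apply: cvg_norm; exact: cvg_id.
Unshelve. all: by end_near. Qed.

Lemma is_derive_flat j (t : R) :
  is_derive t 1 (flat j) (flat j.+2 t - j%:R * flat j.+1 t).
Proof.
have [t0|t0|->] := ltgtP t 0.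
- rewrite !flat_le0 ?ltW// mulr0 subr0.
  apply: (@near_eq_is_derive R R R (cst (0 : R))).
    by near=> s; rewrite flat_le0// ltW//; near: s; exact: lt_nbhsl.
- have -> : flat j.+2 t - j%:R * flat j.+1 t =
     t^-1 ^+ j *: (expR (- t^-1) * t^-1 ^+ 2) +
     expR (- t^-1) *: (j%:R * t^-1 ^+ j.-1 * (- t ^- 2)).
    rewrite /flat t0 /GRing.scale/=; case: j => [|j] /=.
      by rewrite !mul0r mulr0 subr0 addr0 expr0 mul1r mulrC.
    rewrite -!exprVn !exprS !expr0; ring.
  apply: (@near_eq_is_derive R R R ((fun s => s^-1) ^+ j * (fun s => expR (- s^-1)))).
    near=> s; rewrite /flat ifT ?fctE//; near: s; exact: lt_nbhsr.
  have iV : is_derive t 1 (fun s : R => s^-1) (- t ^- 2).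
    by have := @is_deriveV _ id t 1 1 (lt0r_neq0 t0) _; rewrite /GRing.scale/= mulr1; apply.
  have iE : is_derive t 1 (fun s : R => expR (- s^-1)) (expR (- t^-1) * t^-1 ^+ 2).
    apply: (@is_derive1_comp _ (@expR R) (fun s => - s^-1)).
    by apply: (is_derive_eq (is_deriveN iV)); rewrite opprK exprVn.
  apply: (is_derive_eq (is_deriveM (is_deriveX j iV) iE)); rewrite !fctE.
  by rewrite /GRing.scale/= mulr_natl.
(* At 0 the slope function is [flat j.+1], by [flatS]; it is continuous there with value 0. *)
- rewrite !flat_le0// mulr0 subr0; apply/is_derive1_caratheodory.
  exists (flat j.+1); split; [|exact: flat_continuous0|by rewrite flat_le0].
  by move=> z; rewrite [flat j 0]flat_le0// !subr0 -flatS.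
Unshelve. all: by end_near. Qed.
End flat.

(** * Further closure properties of functions of class [Ck] *)

Lemma continuous_bigsum (T : topologicalType) (R : realType) (I : Type) (s : seq I)
    (F : I -> T -> R) (x : T) :
  (forall i, {for x, continuous (F i)}) ->
  {for x, continuous (fun y => \sum_(i <- s) F i y)}.
Proof.
move=> cF; elim: s => [|i s IH].
  rewrite (_ : (fun=> _) = cst 0); first exact: cst_continuous.
  by apply/funext => y; rewrite big_nil.
rewrite (_ : (fun=> _) = F i + (fun y => \sum_(i <- s) F i y)).
  exact: continuousD.
by apply/funext => y; rewrite big_cons.
Qed.

Section Ck_more.
Context (R : realType) (n : nat).
Implicit Types (U W : set 'rV[R]_n) (f g : 'rV[R]_n -> R).

(** Every clause of [Ck] is pointwise, since continuity and derivability refer to the ambient space.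
    Hence [W] need not be open. *)
Lemma Ck_local r U f :
  (forall x, U x -> exists2 W, W x & Ck r W f) -> Ck r U f.
Proof.
elim: r f => [|r IH] f Uf.
  by split => // x /set_mem /Uf[W Wx [cf _]]; apply/cf/mem_set.
split=> [x /set_mem /Uf[W Wx [cf _]]|i]; first exact/cf/mem_set.
split=> [x /Uf[W Wx [_ /(_ i)[df _]]]|]; first exact: df.
by apply: IH => x /Uf[W Wx [_ /(_ i)[_ df]]]; exists W.
Qed.

Context (U : set 'rV[R]_n).
Hypothesis oU : open U.

Lemma CkB r f g : Ck r U f -> Ck r U g -> Ck r U (fun x => f x - g x).
Proof.
move=> Cf Cg.
apply: Ck_ext (CkD oU Cf (CkM oU (Ck_cst oU r (-1)) Cg)) => // x _.
by rewrite !fctE mulN1r.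
Qed.

Lemma Ck_sum (I : Type) (s : seq I) r (F : I -> 'rV[R]_n -> R) :
  (forall i, Ck r U (F i)) -> Ck r U (fun x => \sum_(i <- s) F i x).
Proof.
move=> CF; elim: s => [|i s IH].
  by apply: Ck_ext (Ck_cst oU r 0) => // x _; rewrite big_nil.
by apply: Ck_ext (CkD oU (CF i) IH) => // x _; rewrite big_cons.
Qed.

Let is_derive_flat_comp j f x i : derivable f x (delta_mx 0 i) ->
  is_derive x (delta_mx 0 i) (flat j \o f)
    ((flat j.+2 (f x) - j%:R * flat j.+1 (f x)) * pderiv i f x).
Proof.
by move=> /derivableP df; apply: is_derive_comp1 df (is_derive_flat _ _).
Qed.

(** The induction on [r] treats all [j] together, as differentiating raises the index by one and by
    two. *)
Lemma Ck_flat r j f : Ck r U f -> Ck r U (flat j \o f).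
Proof.
have cflat k (t : R) : {for t, continuous (flat k)}.
  apply: differentiable_continuous; apply/derivable1_diffP.
  exact: (@ex_derive _ _ _ _ _ _ _ (is_derive_flat k t)).
elim: r j f => [|r IH] j f Cf; move: (Cf) => /= [cf df]; split => //.
- by move=> x /cf cfx; apply: continuous_comp cfx _; exact: cflat.
- by move=> x /cf cfx; apply: continuous_comp cfx _; exact: cflat.
move=> i; have [dfi Cfi] := df i; split.
  by move=> x /dfi /(@is_derive_flat_comp j)[].
have Cf' := CkS Cf.
apply: Ck_ext (CkM oU (CkB (IH j.+2 _ Cf')
  (CkM oU (Ck_cst oU r j%:R) (IH j.+1 _ Cf'))) Cfi) => // x /dfi.
by move=> /(@is_derive_flat_comp j)[_]; rewrite /pderiv => ->; rewrite !fctE.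
Qed.

Lemma CkV r f : (forall x, U x -> f x != 0) -> Ck r U f ->
  Ck r U (fun x => (f x)^-1).
Proof.
move=> f0; elim: r => [|r IH] Cf; move: (Cf) => /= [cf df]; split => //.
- by move=> x xU; exact: (cvgV (f0 _ (set_mem xU)) (cf x xU)).
- by move=> x xU; exact: (cvgV (f0 _ (set_mem xU)) (cf x xU)).
move=> i; have [dfi Cfi] := df i; split.
  by move=> x Ux; apply: derivableV; [exact: f0|exact: dfi].
have CV := IH (CkS Cf).
apply: Ck_ext (CkM oU (CkM oU (Ck_cst oU r (-1)) (CkM oU CV CV)) Cfi) => // x Ux.
rewrite /pderiv deriveV//; [|exact: f0|exact: dfi].
by rewrite !fctE /GRing.scale/= mulN1r -invfM expr2.
Qed.
End Ck_more.

(** * Bump functions on a manifold *)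

Section bump.
Context (R : realType) (n : nat) (M : manifold R n).

Lemma cinv_open (c : chart R n M) (O : set M) : open O ->
  open (cimg c `&` cinv c @^-1` O).
Proof.
move=> oO; rewrite openE => x [xc xO]; apply: filterI.
  exact: (open_nbhs_nbhs (conj (cimg_open (c := c)) xc)).
have cx := @cinv_continuous _ _ _ c x (mem_set xc).
by apply: cx; exact: open_nbhs_nbhs.
Qed.

(** Smooth step from 1 on the left of [a] to 0 on the right of [b]. For [a < b] the denominator is
    positive, because [b - q] and [q - a] are never both nonpositive. *)
Definition plateau (a b q : R) : R :=
  flat 0 (b - q) / (flat 0 (b - q) + flat 0 (q - a)).

Section plateau_theory.
Context (a b : R).
Hypothesis ab : a < b.

Lemma plateau_den (q : R) : 0 < flat 0 (b - q) + flat 0 (q - a).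
Proof.
have [qb|bq] := ltP q b.
  by rewrite ltr_pwDl ?flat_ge0// flat0_gt0// subr_gt0.
by rewrite ltr_wpDl ?flat_ge0// flat0_gt0// subr_gt0 (lt_le_trans ab).
Qed.

Lemma plateau_ge0_le1 q : 0 <= plateau a b q <= 1.
Proof.
rewrite divr_ge0 ?flat_ge0 ?(ltW (plateau_den _))//=.
by rewrite ler_pdivrMr ?plateau_den// mul1r lerDl flat_ge0.
Qed.

Lemma plateau1 q : q <= a -> plateau a b q = 1.
Proof.
move=> qa; rewrite /plateau (@flat_le0 _ 0 (q - a)) ?subr_le0// addr0.
by rewrite divff// gt_eqF// flat0_gt0// subr_gt0 (le_lt_trans qa).
Qed.

Lemma plateau0 q : b <= q -> plateau a b q = 0.
Proof. by move=> bq; rewrite /plateau flat_le0 ?mul0r// subr_le0. Qed.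

Lemma Ck_plateau (U : set 'rV[R]_n) r f : open U -> Ck r U f ->
  Ck r U (plateau a b \o f).
Proof.
move=> oU Cf.
have C1 := Ck_flat oU 0 (CkB oU (Ck_cst oU r b) Cf).
have C2 := Ck_flat oU 0 (CkB oU Cf (Ck_cst oU r a)).
apply: Ck_ext (CkM oU C1 (CkV oU _ (CkD oU C1 C2))) => // x _.
by rewrite gt_eqF// plateau_den.
Qed.
End plateau_theory.

(** A step function of the squared distance in a chart, extended by 0. The support lies in the image
    of a closed cube, which is compact and therefore closed in the Hausdorff space [M]; outside the
    chart domain the function is thus 0 on an open set, and the extension is smooth. *)
Lemma bump_exists (p : M) (U : set M) : nbhs p U ->
  exists phi : cinfty M,
    [/\ forall q, 0 <= phi q <= 1, forall q, ~ U q -> phi q = 0 &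
        \forall q \near p, phi q = 1].
Proof.
move=> pU; have [c ca cp] := atlas_cover p.
set x0 := cmap c p; have x0c : cimg c x0 by exact: cmap_img.
have x0U : nbhs x0 (cimg c `&` cinv c @^-1` U).
  apply: filterI; first exact: (open_nbhs_nbhs (conj (cimg_open (c := c)) x0c)).
  have cx := @cinv_continuous _ _ _ c x0 (mem_set x0c).
  by apply: cx; rewrite /x0 cmapK.
have [r /= r0 rU] := (nbhs_ballP _ _).1 x0U.
have r20 : 0 < r / 2 by rewrite divr_gt0.
pose K : set 'rV[R]_n :=
  [set x | forall i, `[x0 0 i - r / 2, x0 0 i + r / 2]%classic (x 0 i)].
have KU : K `<=` cimg c `&` cinv c @^-1` U.
  move=> x Kx; apply: rU; split => // i j; rewrite (ord1 i) /ball/=.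
  have /= := Kx j; rewrite in_itv/= => /andP[K1 K2].
  by rewrite (@le_lt_trans _ _ (r / 2))// ?ler_distl; lra.
have cK : compact K.
  apply: (@rV_compact R n (fun i => `[x0 0 i - r / 2, x0 0 i + r / 2]%classic)) => i.
  exact: segment_compact.
have clK : closed (cinv c @` K).
  apply: compact_closed; first exact: manifold_hausdorff.
  apply: continuous_compact => //; apply: continuous_in_subspaceT => x /set_mem Kx.
  by apply: cinv_continuous; apply/mem_set; have [] := KU _ Kx.
pose q (x : 'rV[R]_n) : R := \sum_j (x 0 j - x0 0 j) ^+ 2.
set b := (r / 2) ^+ 2; have b0 : 0 < b by rewrite exprn_gt0.
have ab : b / 2 < b by lra.
have qK x : ~ K x -> b <= q x.
  move=> /existsNP[i] /negP; rewrite in_itv/= => xi.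
  rewrite /q (bigD1 i)//= ler_wpDr//; first by apply: sumr_ge0 => j _; exact: sqr_ge0.
  rewrite -[leRHS]real_normK ?num_real// ler_sqr ?nnegrE ?normr_ge0 ?(ltW r20)//.
  by rewrite leNgt; apply: contraNN xi; rewrite ltr_distl => /andP[? ?]; rewrite !ltW.
pose phi (m : M) : R := if `[< cdom c m >] then plateau (b / 2) b (q (cmap c m)) else 0.
have sphi : smooth phi.
  move=> c' ca' k; apply: Ck_local => x xc'.
  have [xd|xd] := pselect (cdom c (cinv c' x)).
    exists (cimg c' `&` cinv c' @^-1` cdom c) => //.
    have oW := cinv_open (c:=c') (cdom_open c).
    have Cq : Ck k (cimg c' `&` cinv c' @^-1` cdom c)
       (fun y => \sum_j (cmap c (cinv c' y) 0 j - x0 0 j) ^+ 2).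
      apply: Ck_sum => // j.
      have := CkB oW (atlas_smooth ca' ca j k) (Ck_cst oW k (x0 0 j)).
      by move=> Cj; apply: Ck_ext (CkM oW Cj Cj).
    apply: Ck_ext (Ck_plateau ab oW Cq) => // y [_ yd].
    by rewrite /phi/= asboolT.
  exists (cimg c' `&` cinv c' @^-1` (~` (cinv c @` K))).
    split => // -[z Kz zx]; apply: xd; rewrite -zx; apply: cinv_dom.
    by have [] := KU _ Kz.
  have oW := cinv_open (c:=c') (closed_openC clK).
  apply: Ck_ext (Ck_cst oW k 0) => // y [_ yK].
  rewrite /phi /=; case: asboolP => // yd; rewrite plateau0// qK// => Ky.
  by apply: yK; exists (cmap c (cinv c' y)) => //; rewrite cmapK.
have sphi' : phi \in @smooth_pred R n M by apply/asboolP.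
exists (CInfty sphi'); split => /=.
- by move=> m; rewrite /phi; case: ifP => _; rewrite ?plateau_ge0_le1// lexx ler01.
- move=> m Um; rewrite /phi; case: asboolP => // md; rewrite plateau0// qK// => Km.
  by apply: Um; have [_ /=] := KU _ Km; rewrite cmapK.
have cq : {for x0, continuous q}.
  apply: continuous_bigsum => i.
  have ci : {for x0, continuous (fun x : 'rV[R]_n => x 0 i - x0 0 i)}.
    apply: (@continuousB _ _ _ (fun x : 'rV[R]_n => x 0 i) (cst (x0 0 i))).
      exact: coord_continuous.
    exact: cst_continuous.
  exact: (continuousM ci ci).
have pd : \forall m \near p, cdom c m by exact: (open_nbhs_nbhs (conj (cdom_open c) cp)).
have qb : \forall m \near p, q (cmap c m) < b / 2.
  have cx := @cmap_continuous _ _ _ c p (mem_set cp).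
  apply: (cx [set x | q x < b / 2]); apply: (cq [set t | t < b / 2]).
  apply: lt_nbhsl.
  by rewrite /q big1 ?divr_gt0// => i _; rewrite subrr expr0n.
near=> m; rewrite /phi asboolT; last by near: m.
by rewrite plateau1// ltW//; near: m.
Unshelve. all: by end_near. Qed.

End bump.

(** * Germs of smooth functions and locality of tangent vectors *)

Section germs.
Context (R : realType) (n : nat) (M : manifold R n).
Implicit Types (f g h : cinfty M) (p q : M).

Definition evalc q f : R := f q.

Fact evalc_zmod q : zmod_morphism (evalc q). Proof. by []. Qed.
Fact evalc_monoid q : monoid_morphism (evalc q). Proof. by []. Qed.
HB.instance Definition _ q :=
  GRing.isZmodMorphism.Build (cinfty M) R (evalc q) (evalc_zmod q).
HB.instance Definition _ q :=
  GRing.isMonoidMorphism.Build (cinfty M) R (evalc q) (evalc_monoid q).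

Lemma cinfty_sumE (I : Type) (s : seq I) (F : I -> cinfty M) q :
  (\sum_(i <- s) F i) q = \sum_(i <- s) F i q.
Proof. exact: (raddf_sum (evalc q)). Qed.

Lemma cinftyME f g q : (f * g) q = f q * g q. Proof. by []. Qed.

Lemma cinfty_eqP f g : (forall q, f q = g q) -> f = g.
Proof. by move=> fg; apply/val_inj/funext. Qed.

Lemma cinfty_scalerAr (a : R) f g : a *: (f * g) = f * (a *: g).
Proof. by apply: cinfty_eqP => q; exact: mulrCA. Qed.

Lemma cinfty_continuous f : continuous f.
Proof.
move=> p; have [c ca cp] := atlas_cover p.
have fc : {for cmap c p, continuous (f \o cinv c)}.
  have /asboolP sf := cinftyP f.
  by have [cf _] := sf c ca 0; apply/cf/mem_set/cmap_img.
have cc := @cmap_continuous _ _ _ c p (mem_set cp).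
have fcc := continuous_comp cc fc.
rewrite /continuous_at -[X in nbhs (f X)](cmapK cp).
apply: cvg_trans fcc; apply: near_eq_cvg.
have : nbhs p (cdom c) by exact: (open_nbhs_nbhs (conj (cdom_open c) cp)).
by apply: filterS => m md; rewrite /= cmapK.
Qed.

Definition germ_eq p f g := \forall q \near p, f q = g q.

Lemma germ_refl p f : germ_eq p f f.
Proof. exact: nearW. Qed.

Lemma germ_sym p f g : germ_eq p f g -> germ_eq p g f.
Proof. by apply: filterS => q ->. Qed.

Lemma germ_trans p f g h : germ_eq p f g -> germ_eq p g h -> germ_eq p f h.
Proof. by apply: filterS2 => q ->. Qed.

Lemma germD p f f' g g' : germ_eq p f f' -> germ_eq p g g' ->
  germ_eq p (f + g) (f' + g').
Proof. by apply: filterS2 => q /= fE gE; rewrite -[LHS]/(f q + g q) fE gE. Qed.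

Lemma germB p f f' g g' : germ_eq p f f' -> germ_eq p g g' ->
  germ_eq p (f - g) (f' - g').
Proof. by apply: filterS2 => q /= fE gE; rewrite -[LHS]/(f q - g q) fE gE. Qed.

Lemma germM p f f' g g' : germ_eq p f f' -> germ_eq p g g' ->
  germ_eq p (f * g) (f' * g').
Proof. by apply: filterS2 => q /= fE gE; rewrite -[LHS]/(f q * g q) fE gE. Qed.

Lemma germ_near p f g : germ_eq p f g -> \forall q \near p, germ_eq q f g.
Proof. exact: nbhs_interior. Qed.

(** With a bump [phi] supported where f is nonzero, F = phi f^2 + (1 - phi) has no zero, so f / F is
    a global smooth function; it equals 1 / f where [phi] is 1. *)
Lemma germ_inverse p f : f p != 0 -> exists g, germ_eq p (f * g) 1.
Proof.
move=> fp; have fN0 : \forall q \near p, f q != 0.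
  exact: (cinfty_continuous (open_nbhs_nbhs (conj (@open_neq _ 0) fp))).
have [phi [phi01 phi0 phi1]] := bump_exists fN0.
pose F : cinfty M := phi * f ^+ 2 + (1 - phi).
have FE q : F q = phi q * f q ^+ 2 + (1 - phi q) by rewrite expr2.
have F0 q : F q != 0.
  rewrite FE gt_eqF//; have /andP[p0 p1] := phi01 q.
  have [fq|/negP fq] := boolP (f q != 0); last by rewrite phi0// mul0r add0r subr0.
  have f2 : 0 < f q ^+ 2 by rewrite exprn_even_gt0.
  move: p0; rewrite le_eqVlt => /predU1P[<-|p0]; first by rewrite mul0r add0r subr0.
  by apply: ltr_pwDl; [exact: mulr_gt0|rewrite subr_ge0].
have sV : smooth (fun q => (F q)^-1).
  move=> c ca r; have /asboolP sF := cinftyP F.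
  by apply: CkV (sF c ca r) => [|x _]; [exact: cimg_open|exact: F0].
have sV' : (fun q => (F q)^-1) \in @smooth_pred R n M by exact/asboolP.
exists (f * CInfty sV'); move: phi1 fN0; apply: filterS2 => q p1 fq.
rewrite -[LHS]/(f q * (f q * (F q)^-1)) FE p1 subrr addr0 mul1r mulrA -expr2.
by rewrite divff// expf_neq0.
Qed.

Lemma matrix_germ_inverse p N (A : 'M[cinfty M]_N) :
  map_mx (evalc p) A \in unitmx ->
  exists B : 'M[cinfty M]_N,
    \forall q \near p, map_mx (evalc q) A *m map_mx (evalc q) B = 1%:M.
Proof.
rewrite unitmxE unitfE det_map_mx => /germ_inverse[g dg].
exists (g *: \adj A); move: dg; apply: filterS => q dg.
rewrite -map_mxM -scalemxAr mul_mx_adj scale_scalar_mx map_scalar_mx mulrC.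
by congr _%:M; exact: dg.
Qed.

(** If [phi] is 1 near [p] and 0 wherever f and g differ, then phi (f - g) is 0 everywhere, and the
    Leibniz rule at [p] reduces v of it to v (f - g). *)
Lemma tangent_local p (v : cinfty M -> R) f g :
  tangent p v -> germ_eq p f g -> v f = v g.
Proof.
move=> [vD vM] fg.
have v0 : v 0 = 0 by have := vD (-1) 0 0; rewrite scaler0 addr0 mulN1r addNr.
have [phi [_ phi0 phi1]] := bump_exists fg.
have e : phi * (f - g) = 0.
  apply: cinfty_eqP => q; rewrite -[LHS]/(phi q * (f q - g q)).
  have [->|ne] := pselect (f q = g q); first by rewrite subrr mulr0.
  by rewrite phi0// mul0r.
have := vM phi (f - g); rewrite e v0 (nbhs_singleton phi1) mul1r.
rewrite -[(f - g) p]/(f p - g p) (nbhs_singleton fg) subrr mul0r addr0.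
have -> : f - g = (-1) *: g + f by rewrite scaleN1r addrC.
by rewrite vD mulN1r => /eqP; rewrite eq_sym addrC subr_eq0 => /eqP.
Qed.
End germs.

(** * Vector fields and frames *)

(** Here [xf] stands for X f, [xyf] for X (Y f), and so on. The products of two first derivatives
    cancel, which makes the bracket a derivation. *)
Lemma bracket_leibniz (T : comPzRingType) (f g xf xg yf yg xyf xyg yxf yxg : T) :
  f * xyg + yg * xf + (g * xyf + yf * xg) -
  (f * yxg + xg * yf + (g * yxf + xf * yg)) =
  f * (xyg - yxg) + g * (xyf - yxf).
Proof. ring. Qed.

Section vector_fields.
Context (R : realType) (n : nat) (M : manifold R n).
Implicit Types (f g h : cinfty M) (p q : M) (X Y Z : cinfty M -> cinfty M).

Lemma vf_tangent X p : vector_field X -> tangent p (value_at X p).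
Proof.
by case=> XD XM; split=> [a f g|f g]; rewrite /value_at ?XD ?XM.
Qed.

Lemma vf_local X p f g : vector_field X -> germ_eq p f g -> germ_eq p (X f) (X g).
Proof.
move=> vX /germ_near; apply: filterS => q.
exact: (tangent_local (vf_tangent q vX)).
Qed.

Lemma vfD X f g : vector_field X -> X (f + g) = X f + X g.
Proof. by case=> XD _; have := XD 1 f g; rewrite !scale1r. Qed.

Lemma vf0 X : vector_field X -> X 0 = 0.
Proof. by move=> vX; have := vX.1 (-1) 0 0; rewrite scaler0 addr0 scaleN1r addNr. Qed.

Lemma vfZ X (a : R) f : vector_field X -> X (a *: f) = a *: X f.
Proof. by move=> vX; have := vX.1 a f 0; rewrite (vf0 vX) !addr0. Qed.

Lemma vfB X f g : vector_field X -> X (f - g) = X f - X g.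
Proof. by move=> vX; rewrite -scaleN1r (vfD _ _ vX) (vfZ _ _ vX) scaleN1r. Qed.

Lemma vfM X f g : vector_field X -> X (f * g) = f * X g + g * X f.
Proof. by case. Qed.

Lemma vf_sum X (I : Type) (s : seq I) (F : I -> cinfty M) : vector_field X ->
  X (\sum_(i <- s) F i) = \sum_(i <- s) X (F i).
Proof.
move=> vX; elim: s => [|i s IH]; first by rewrite !big_nil (vf0 vX).
by rewrite !big_cons (vfD _ _ vX) IH.
Qed.

Lemma vf_bracket X Y : vector_field X -> vector_field Y -> vector_field (bracket X Y).
Proof.
move=> vX vY; split=> [a f g|f g]; rewrite /bracket.
  rewrite (vY.1 a) (vX.1 a) (vX.1 a) (vY.1 a) scalerBr opprD !addrA.
  by congr (_ - _); rewrite -!addrA; congr (_ + _); rewrite addrC.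
rewrite (vfM f g vY) (vfM f g vX) (vfD _ _ vX) (vfD _ _ vY).
by rewrite !(vfM _ _ vX) !(vfM _ _ vY) bracket_leibniz.
Qed.

Lemma vf_comb (I : Type) (s : seq I) (c : I -> cinfty M) (X : I -> cinfty M -> cinfty M) :
  (forall i, vector_field (X i)) ->
  vector_field (fun f => \sum_(i <- s) c i * X i f).
Proof.
move=> vX; split=> [a f g|f g].
  rewrite scaler_sumr -big_split; apply: eq_bigr => i _ /=.
  by rewrite (vX i).1 mulrDr cinfty_scalerAr.
rewrite !mulr_sumr -big_split; apply: eq_bigr => i _ /=.
by rewrite (vX i).2 mulrDr ![c i * (_ * _)]mulrCA.
Qed.
End vector_fields.

(** * Dual vectors for independent functionals *)

Section dual_family.
Context (R : realType) (V : lmodType R).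

Lemma dual_family N (phi : 'I_N -> V -> R) :
  (forall a c x y, phi a (c *: x + y) = c * phi a x + phi a y) ->
  (forall c : 'I_N -> R, (forall x, \sum_a c a * phi a x = 0) -> forall a, c a = 0) ->
  exists f : 'I_N -> V, forall a b, phi a (f b) = (a == b)%:R.
Proof.
elim: N phi => [|N IH] phi lin free; first by exists (fun=> 0) => -[].
have phiD a x y : phi a (x + y) = phi a x + phi a y.
  by have := lin a 1 x y; rewrite scale1r mul1r.
have phi0 a : phi a 0 = 0.
  by have := lin a (-1) 0 0; rewrite scaler0 addr0 mulN1r addNr.
have phiZ a c x : phi a (c *: x) = c * phi a x.
  by have := lin a c x 0; rewrite phi0 !addr0.
have phi_sum a (F : 'I_N -> V) : phi a (\sum_i F i) = \sum_i phi a (F i).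
  by apply: (big_morph (phi a)).
have [|c cfree i|f fE] := IH (fun i => phi (lift ord0 i)); first by move=> *; exact: lin.
  have := free (fun a => if unlift ord0 a is Some i then c i else 0) _ (lift ord0 i).
  rewrite liftK; apply => x; rewrite big_ord_recl unlift_none mul0r add0r.
  by rewrite -[RHS](cfree x); apply: eq_bigr => j _; rewrite liftK.
(* The subtracted combination agrees with [phi ord0] on all [f b]; by independence it is not equal
   to [phi ord0]. *)
have [x psix] : exists x, phi ord0 x - \sum_b phi ord0 (f b) * phi (lift ord0 b) x != 0.
  apply: contrapT => /forallNP nx.
  have := free (fun a => if unlift ord0 a is Some b then - phi ord0 (f b) else 1) _ ord0.
  rewrite unlift_none => one0; suff /eqP : (1 : R) = 0 by rewrite oner_eq0.
  apply: one0 => x; have /negP/negPn/eqP nxx := nx x; rewrite -[RHS]nxx.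
  rewrite big_ord_recl unlift_none mul1r -sumrN; congr (_ + _).
  by apply: eq_bigr => b _; rewrite liftK mulNr.
set d := (X in X != 0) in psix.
(* Removing the components of [x] along [f] kills the other functionals, and [d] is then the value
   of [phi ord0]. *)
pose g := d^-1 *: (x - \sum_b phi (lift ord0 b) x *: f b).
have g1 : phi ord0 g = 1.
  rewrite phiZ phiD -scaleN1r phiZ phi_sum mulN1r.
  under eq_bigr => b _ do rewrite phiZ mulrC.
  exact: mulVf.
have g0 b : phi (lift ord0 b) g = 0.
  rewrite phiZ phiD -scaleN1r phiZ phi_sum mulN1r.
  under eq_bigr => c _ do rewrite phiZ fE mulr_natr.
  rewrite (bigD1 b)//= eqxx mulr1n big1 ?addr0 ?subrr ?mulr0// => c cb.
  by rewrite eq_sym (negbTE cb).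
clearbody g.
exists (fun a => if unlift ord0 a is Some b then f b - phi ord0 (f b) *: g else g).
move=> a b; cbv beta.
case: (unliftP ord0 a) => [i|] ->; case: (unliftP ord0 b) => [j|] ->.
- by rewrite phiD -scaleN1r !phiZ g0 !mulr0 addr0 fE (inj_eq lift_inj).
- by rewrite g0 lift_eqF.
- by rewrite phiD -scaleN1r !phiZ g1 mulr1 mulN1r subrr eq_liftF.
- by rewrite g1 eqxx.
Qed.
End dual_family.

(** * Local frames and expansions in them *)

Section frames.
Context (R : realType) (n : nat) (M : manifold R n).
Implicit Types (f g h : cinfty M) (p q : M) (X Y Z : cinfty M -> cinfty M).

Lemma comb_apply (I : finType) (y : I -> R) (e : I -> (cinfty M -> R)) g :
  (\sum_i y i *: e i) g = \sum_i y i * e i g.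
Proof. by rewrite fct_sumE. Qed.

(** The matrix E_a(f_b) is the identity at [p], hence invertible near [p]. There the N vectors E_a
    are independent inside a space spanned by N vectors, so they form a basis, and [B] reads
    components off values on [f]. *)
Lemma frame_expand p N (E : 'I_N -> cinfty M -> cinfty M) (f : 'I_N -> cinfty M) :
  (forall a, vector_field (E a)) ->
  (forall a b, E a (f b) p = (a == b)%:R) ->
  (forall q, exists e : 'I_N -> (cinfty M -> R), forall v, tangent q v ->
     exists y : 'I_N -> R, v = \sum_a y a *: e a) ->
  exists B : 'M[cinfty M]_N, \forall q \near p,
    (forall a b, \sum_c E a (f c) q * B c b q = (a == b)%:R) /\
    (forall v, tangent q v -> forall g,
      v g = \sum_a (\sum_c v (f c) * B c a q) * E a g q).
Proof.
move=> vE Ef span; pose A : 'M[cinfty M]_N := \matrix_(a, b) E a (f b).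
have A1 : map_mx (evalc p) A = 1%:M.
  by apply/matrixP => a b; rewrite !mxE; exact: Ef.
have [|B AB] := @matrix_germ_inverse _ _ _ p _ A; first by rewrite A1 unitmx1.
exists B; move: AB; apply: filterS => q AB.
have ABE a b : \sum_c E a (f c) q * B c b q = (a == b)%:R.
  have /matrixP/(_ a b) := AB; rewrite !mxE => <-.
  by apply: eq_bigr => c _; rewrite !mxE.
split=> // v tv g; have [e eE] := span q.
have /choice[P PE] : forall a, exists y : 'I_N -> R, value_at (E a) q = \sum_b y b *: e b.
  by move=> a; exact/eE/vf_tangent.
have [y vE'] := eE v tv.
pose Pm := \matrix_(a, b) P a b; pose em := \matrix_(a, b) e a (f b).
(* The invertible matrix [A] factors through the change-of-family matrix [Pm], which is therefore
   invertible; this expresses [e] through [E]. *)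
have PA : Pm *m em = map_mx (evalc q) A.
  apply/matrixP => a b; rewrite !mxE.
  transitivity (value_at (E a) q (f b)); last by [].
  rewrite PE comb_apply.
  by apply: eq_bigr => c _; rewrite !mxE.
have uP : Pm \in unitmx.
  have : Pm *m (em *m map_mx (evalc q) B) = 1%:M by rewrite mulmxA PA.
  by case/mulmx1_unit.
pose z := (\row_a y a) *m invmx Pm.
have zP b : \sum_a z 0 a * P a b = y b.
  have : (z *m Pm) 0 b = y b by rewrite mulmxKV// mxE.
  by rewrite [X in X = _]mxE => <-; apply: eq_bigr => a _; congr (_ * _); rewrite [RHS]mxE.
have vz h : v h = \sum_a z 0 a * E a h q.
  rewrite vE' comb_apply.
  under eq_bigr => b _ do rewrite -zP mulr_suml.
  rewrite exchange_big; apply: eq_bigr => a _.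
  have -> : E a h q = value_at (E a) q h by [].
  rewrite PE comb_apply.
  by rewrite mulr_sumr; apply: eq_bigr => b _; rewrite mulrA.
rewrite vz; apply: eq_bigr => a _; congr (_ * _).
under eq_bigr => c _ do rewrite vz mulr_suml.
rewrite exchange_big /= (bigD1 a)//= [X in _ + X]big1 ?addr0 => [|b ba].
  by under eq_bigr => c _ do rewrite -mulrA; rewrite -mulr_sumr ABE eqxx mulr1.
by under eq_bigr => c _ do rewrite -mulrA; rewrite -mulr_sumr ABE (negbTE ba) mulr0.
Qed.

Section subbundle_theory.
Context (r : nat) (D : M -> set (cinfty M -> R)).
Hypothesis sD : subbundle r D.

Lemma subbundle_basis q : exists e : 'I_r -> (cinfty M -> R), is_basis (D q) e.
Proof.
by have [X [_ /nbhs_singleton b]] := sD q; exists (fun i => value_at (X i) q).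
Qed.

Lemma subbundle0 q : D q 0.
Proof.
have [e [_ ->]] := subbundle_basis q; exists (fun=> 0).
by rewrite big1// => i _; rewrite scale0r.
Qed.

Lemma subbundle_lin q a u v : D q u -> D q v -> D q (a *: u + v).
Proof.
have [e [_ ->]] := subbundle_basis q => -[c ->] [d ->].
exists (fun i => a * c i + d i); rewrite scaler_sumr -big_split.
by apply: eq_bigr => i _; rewrite /= scalerDl scalerA.
Qed.

Lemma subbundle_sum q (I : finType) (c : I -> R) (u : I -> (cinfty M -> R)) :
  (forall i, D q (u i)) -> D q (\sum_i c i *: u i).
Proof.
move=> Du; elim/big_ind: _ => [|v w Dv Dw|i _]; first exact: subbundle0.
  by rewrite -[v]scale1r; exact: subbundle_lin.
by rewrite -[_ *: _]addr0; apply: subbundle_lin => //; exact: subbundle0.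
Qed.

Lemma section_comb (I : finType) (c : I -> cinfty M) (X : I -> cinfty M -> cinfty M) :
  (forall i, section D (X i)) -> section D (fun f => \sum_i c i * X i f).
Proof.
move=> sX; split; first by apply: vf_comb => i; exact: (sX i).1.
move=> q; have := @subbundle_sum q I (fun i => c i q) (fun i => value_at (X i) q)
  (fun i => (sX i).2 q).
by congr (D q _); apply/funext => f; rewrite comb_apply /value_at cinfty_sumE.
Qed.

(* Multiplying by a bump function turns the local frames of [subbundle] into
   global sections. *)
Lemma subbundle_frame p : exists X : 'I_r -> (cinfty M -> cinfty M),
  (forall i, section D (X i)) /\
  \forall q \near p, is_basis (D q) (fun i => value_at (X i) q).
Proof.
have [X [vX bX]] := sD p; have [phi [_ phi0 phi1]] := bump_exists bX.
exists (fun i f => phi * X i f); split => [i|].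
  split; first by have := vf_comb [:: tt] (fun=> phi) (fun=> vX i);
    congr vector_field; apply/funext => f; rewrite big_seq1.
  move=> q; have -> : value_at (fun f => phi * X i f) q = phi q *: value_at (X i) q by [].
  have [[_ ->]|nb] := pselect (is_basis (D q) (fun i => value_at (X i) q)).
    exists (fun j => phi q *+ (j == i)); rewrite (bigD1 i)//= eqxx big1 ?addr0// => j ji.
    by rewrite (negbTE ji) mulr0n scale0r.
  by rewrite phi0// scale0r; exact: subbundle0.
move: phi1 bX; apply: filterS2 => q p1; congr is_basis.
apply/funext => i; apply/funext => f.
by rewrite /value_at -[RHS]/(phi q * X i f q) p1 mul1r.
Qed.
End subbundle_theory.

End frames.

(** * Germ ideals *)

Section germ_ideal.
Context (R : realType) (n : nat) (M : manifold R n) (p : M).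
Context (I : finType) (u : I -> cinfty M).
Implicit Types (f g h : cinfty M).

(** The ideal generated by the [u i] in the ring of germs at [p], with global functions standing for
    germs. *)
Definition germ_ideal g := exists a : I -> cinfty M, germ_eq p g (\sum_i a i * u i).

Lemma germ_ideal_germ f g : germ_eq p f g -> germ_ideal g -> germ_ideal f.
Proof. by move=> fg [a ga]; exists a; exact: germ_trans fg ga. Qed.

Lemma germ_ideal_gen i : germ_ideal (u i).
Proof.
exists (fun j => (j == i)%:R); rewrite (bigD1 i)//= eqxx mul1r big1 ?addr0.
  exact: germ_refl.
by move=> j /negbTE ->; rewrite mul0r.
Qed.

Lemma germ_idealD f g : germ_ideal f -> germ_ideal g -> germ_ideal (f + g).
Proof.
move=> [a fa] [b gb]; exists (fun i => a i + b i).
have -> : \sum_i (a i + b i) * u i = \sum_i a i * u i + \sum_i b i * u i.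
  by rewrite -big_split; apply: eq_bigr => i _; rewrite mulrDl.
exact: germD.
Qed.

Lemma germ_idealMl f g : germ_ideal g -> germ_ideal (f * g).
Proof.
move=> [a ga]; exists (fun i => f * a i).
have -> : \sum_i f * a i * u i = f * \sum_i a i * u i.
  by rewrite mulr_sumr; apply: eq_bigr => i _; rewrite mulrA.
by apply: germM => //; exact: germ_refl.
Qed.

Lemma germ_idealMr f g : germ_ideal f -> germ_ideal (f * g).
Proof. by rewrite mulrC; exact: germ_idealMl. Qed.

Lemma germ_idealN f : germ_ideal f -> germ_ideal (- f).
Proof. by rewrite -mulN1r; exact: germ_idealMl. Qed.

Lemma germ_idealB f g : germ_ideal f -> germ_ideal g -> germ_ideal (f - g).
Proof. by move=> Jf Jg; apply: germ_idealD => //; exact: germ_idealN. Qed.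

Lemma germ_ideal_sum (L : finType) (F : L -> cinfty M) :
  (forall l, germ_ideal (F l)) -> germ_ideal (\sum_l F l).
Proof.
move=> JF; elim/big_ind: _ => //; last exact: germ_idealD.
exists (fun=> 0); rewrite big1 => [|i _]; first exact: germ_refl.
by rewrite mul0r.
Qed.

Lemma germ_ideal_half f : germ_ideal (f + f) -> germ_ideal f.
Proof.
pose c : cinfty M := 2^-1 *: (1 : cinfty M).
move=> /(germ_idealMl c); suff -> : c * (f + f) = f by [].
apply: cinfty_eqP => q.
rewrite -[LHS]/(2^-1 * 1 * (f q + f q)); lra.
Qed.

Lemma germ_ideal_vf X g : vector_field X -> (forall i, germ_ideal (X (u i))) ->
  germ_ideal g -> germ_ideal (X g).
Proof.
move=> vX Xu [a /(vf_local vX) ga]; apply: germ_ideal_germ ga _.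
rewrite (vf_sum _ _ vX); apply: germ_ideal_sum => i; rewrite (vfM _ _ vX).
apply: germ_idealD; first exact/germ_idealMl/Xu.
exact/germ_idealMr/germ_ideal_gen.
Qed.
End germ_ideal.

(** * The metric on horizontal vectors and sections *)

Section sub_riemannian_theory.
Context (R : realType) (n k : nat) (M : manifold R n) (S : sub_riemannian k M).
Implicit Types (f g h : cinfty M) (p q : M) (X Y Z : cinfty M -> cinfty M).
Let sH := horizontal_subbundle S.

Lemma metric0l q w : horizontal S q w -> metric S q 0 w = 0.
Proof.
move=> hw; have h0 := subbundle0 sH q.
by have := @metric_linear _ _ _ _ S q (-1) 0 0 w h0 h0 hw;
  rewrite scaler0 addr0 mulN1r addNr.
Qed.

Lemma metric_suml q (I : finType) (c : I -> R) (e : I -> (cinfty M -> R)) w :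
  (forall i, horizontal S q (e i)) -> horizontal S q w ->
  metric S q (\sum_i c i *: e i) w = \sum_i c i * metric S q (e i) w.
Proof.
(* Linearity is only available on horizontal vectors, so membership is carried along in the
   induction. *)
move=> he hw; pose P v s := horizontal S q v /\ metric S q v w = s.
suff [] : P (\sum_i c i *: e i) (\sum_i c i * metric S q (e i) w) by [].
elim/big_rec2: _ => [|i s v _ [hv vs]]; first by split; [exact: subbundle0|exact: metric0l].
by split; [exact: subbundle_lin|rewrite metric_linear// vs].
Qed.

Lemma iterated_vf X : iterated_bracket (horizontal S) X -> vector_field X.
Proof. by elim => [Y []//|Y Z _ vY _ vZ]; exact: vf_bracket. Qed.

Lemma inner_cinfty X Y : section (horizontal S) X -> section (horizontal S) Y ->
  exists h : cinfty M, h =1 inner S X Y.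
Proof.
move=> sX sY; have sm : inner S X Y \in @smooth_pred R n M.
  by apply/asboolP; exact: metric_smooth.
by exists (CInfty sm).
Qed.

(* The default value [0] only occurs when [inner S X Y] is not smooth. *)
Definition innerc X Y : cinfty M := xget 0 [set h : cinfty M | h =1 inner S X Y].

Lemma innercE X Y q : section (horizontal S) X -> section (horizontal S) Y ->
  innerc X Y q = metric S q (value_at X q) (value_at Y q).
Proof.
move=> sX sY; rewrite /innerc; case: xgetP => [h _ /(_ q)//|].
by have [h hE] := inner_cinfty sX sY => /(_ h).
Qed.

Lemma innercC X Y : section (horizontal S) X -> section (horizontal S) Y ->
  innerc X Y = innerc Y X.
Proof.
move=> sX sY; apply: cinfty_eqP => q; rewrite !innercE//.
by apply: Defs.metric_sym; [exact: sX.2|exact: sY.2].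
Qed.
End sub_riemannian_theory.

(** * The ideal of a Killing field is preserved by horizontal fields *)

(** The letters stand for XKY, XYK, KYX, YKX, YXK and KXY applied to a function: [X, [K, Y]] - [Y,
    [K, X]] = [K, [X, Y]]. *)
Lemma jacobi_identity (T : comPzRingType) (a b c d e f : T) :
  a - b - (c - d) - (d - e - (f - a)) = f - c - (b - e).
Proof. ring. Qed.

(** The letters run through the six permutations of the arguments of a trilinear form, swapping
    alternately the first two and the last two. Differences are symmetry defects and sums are
    skewness defects; three sign changes around the cycle produce the factor 2. *)
Lemma skew_sym_telescope (T : comPzRingType) (a b c d e f : T) :
  a + a = (a - b) + (b + c) - (c - d) - (d + e) + (e - f) + (f + a).
Proof. ring. Qed.

Section killing_ideal.
Context (R : realType) (n k m : nat) (M : manifold R n) (S : sRC_structure k m M).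
Local Notation N := (k + m)%N.
Local Notation H := (horizontal S).
Local Notation V := (vertical S).
Context (p : M) (E : 'I_N -> cinfty M -> cinfty M) (f : 'I_N -> cinfty M)
  (B : 'M[cinfty M]_N).
Hypothesis EH : forall i, section H (E (lshift m i)).
Hypothesis EV : forall j, section V (E (rshift k j)).
Hypothesis bH : \forall q \near p, is_basis (H q) (fun i => value_at (E (lshift m i)) q).
Hypothesis bV : \forall q \near p, is_basis (V q) (fun j => value_at (E (rshift k j)) q).
Hypothesis EfB : \forall q \near p,
  (forall a b, \sum_c E a (f c) q * B c b q = (a == b)%:R) /\
  (forall v, tangent q v -> forall g,
     v g = \sum_a (\sum_c v (f c) * B c a q) * E a g q).
Implicit Types (g h : cinfty M) (q : M) (X Y Z : cinfty M -> cinfty M).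

Let vE a : vector_field (E a).
Proof. by case: (split_ordP a) => i ->; [exact: (EH i).1|exact: (EV i).1]. Qed.

(** Near [p] this is the component of [Z] along [E a]; farther away it has no geometric meaning. *)
Definition coef a Z : cinfty M := \sum_c Z (f c) * B c a.

Lemma coefE a Z q : coef a Z q = \sum_c Z (f c) q * B c a q.
Proof. exact: cinfty_sumE. Qed.

Lemma coef_expand Z g : vector_field Z ->
  germ_eq p (Z g) (\sum_a coef a Z * E a g).
Proof.
move=> vZ; apply: filterS EfB => q [_ /(_ _ (vf_tangent q vZ) g) ZE].
rewrite cinfty_sumE [LHS]ZE; apply: eq_bigr => a _.
by rewrite cinftyME coefE.
Qed.

(** Uniqueness of frame components. It allows passing from a combination whose values all lie in the
    ideal to its coefficients. *)
Lemma coef_comb (c : 'I_N -> cinfty M) a :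
  germ_eq p (\sum_d (\sum_b c b * E b (f d)) * B d a) (c a).
Proof.
apply: filterS EfB => q [EB _]; rewrite cinfty_sumE.
transitivity (\sum_d \sum_b c b q * (E b (f d) q * B d a q)).
  apply: eq_bigr => d _; rewrite cinftyME cinfty_sumE mulr_suml.
  by apply: eq_bigr => b _; rewrite cinftyME mulrA.
rewrite exchange_big (bigD1 a)//= [X in _ + X]big1 ?addr0 => [|b ba].
  by rewrite -mulr_sumr EB eqxx mulr1.
by rewrite -mulr_sumr EB (negbTE ba) mulr0.
Qed.

(** A section of the span of a subfamily has no other components: its expansion there, tested on [f]
    against [B], returns its own coefficients. *)
Lemma coef_section (D : M -> set (cinfty M -> R)) r (j : 'I_r -> 'I_N) Z :
  injective j ->
  (\forall q \near p, is_basis (D q) (fun i => value_at (E (j i)) q)) ->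
  section D Z ->
  \forall q \near p, value_at Z q = \sum_i coef (j i) Z q *: value_at (E (j i)) q.
Proof.
move=> jI bD [_ DZ]; move: bD EfB; apply: filterS2 => q [_ Dq] [EB _].
have := DZ q; rewrite Dq => -[c cE]; rewrite cE; apply: eq_bigr => i _; congr (_ *: _).
rewrite coefE.
have ZE g : Z g q = \sum_i c i * E (j i) g q.
  by rewrite -[LHS]/(value_at Z q g) cE comb_apply.
under eq_bigr => d _ do rewrite ZE mulr_suml.
rewrite exchange_big /= (bigD1 i)//= [X in _ + X]big1 ?addr0 => [|b bi].
  by under eq_bigr => d _ do rewrite -mulrA; rewrite -mulr_sumr EB eqxx mulr1.
under eq_bigr => d _ do rewrite -mulrA.
by rewrite -mulr_sumr EB (inj_eq jI) (negbTE bi) mulr0.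
Qed.

Lemma coef_section_germ (D : M -> set (cinfty M -> R)) r (j : 'I_r -> 'I_N) Z g :
  injective j ->
  (\forall q \near p, is_basis (D q) (fun i => value_at (E (j i)) q)) ->
  section D Z -> germ_eq p (Z g) (\sum_i coef (j i) Z * E (j i) g).
Proof.
move=> jI bD sZ; apply: filterS (coef_section jI bD sZ) => q ZE.
by rewrite -[LHS]/(value_at Z q g) ZE comb_apply cinfty_sumE.
Qed.

Lemma coefH Z g : section H Z ->
  germ_eq p (Z g) (\sum_i coef (lshift m i) Z * E (lshift m i) g).
Proof. by apply: coef_section_germ bH; exact: lshift_inj. Qed.

Lemma coefV Z g : section V Z ->
  germ_eq p (Z g) (\sum_j coef (rshift k j) Z * E (rshift k j) g).
Proof. by apply: coef_section_germ bV; exact: rshift_inj. Qed.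

Context (K : cinfty M -> cinfty M).
Hypothesis KK : H_Killing S K.

Let vK : vector_field K. Proof. by case: KK. Qed.
Let KH X : section H X -> section H (bracket K X).
Proof. by case: KK => _ + _ _; apply. Qed.
Let KV X : section V X -> section V (bracket K X).
Proof. by case: KK => _ _ + _; apply. Qed.

(** Values on [f] and on the horizontal frame are enough to generate all K g and, by the Leibniz
    rule, all [K, X] g with X horizontal. *)
Definition killing_gen (s : 'I_N + 'I_k * 'I_N) : cinfty M :=
  match s with
  | inl c => K (f c)
  | inr (i, c) => bracket K (E (lshift m i)) (f c)
  end.

Local Notation J := (germ_ideal p killing_gen).

Lemma ideal_coef a Z : (forall g, J (Z g)) -> J (coef a Z).
Proof. by move=> JZ; apply: germ_ideal_sum => c; exact: germ_idealMr. Qed.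

Lemma ideal_expand Z g : vector_field Z -> (forall c, J (Z (f c))) -> J (Z g).
Proof.
move=> vZ JZ; apply: germ_ideal_germ (coef_expand g vZ) _.
apply: germ_ideal_sum => a; apply: germ_idealMr.
by apply: germ_ideal_sum => c; exact: germ_idealMr.
Qed.

Lemma ideal_K g : J (K g).
Proof. by apply: ideal_expand => // c; exact: (germ_ideal_gen _ _ (inl c)). Qed.

Lemma ideal_KE i g : J (bracket K (E (lshift m i)) g).
Proof.
apply: ideal_expand; first by apply: vf_bracket.
by move=> c; exact: (germ_ideal_gen _ _ (inr (i, c))).
Qed.

Lemma bracket_comb_germ Z X (c : 'I_k -> cinfty M) g : vector_field Z ->
  (forall h, germ_eq p (X h) (\sum_i c i * E (lshift m i) h)) ->
  germ_eq p (bracket Z X g)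
    (\sum_i (Z (c i) * E (lshift m i) g + c i * bracket Z (E (lshift m i)) g)).
Proof.
move=> vZ XE; have := germB (vf_local vZ (XE g)) (XE (Z g)).
congr germ_eq; rewrite (vf_sum _ _ vZ) -sumrB; apply: eq_bigr => i _.
by rewrite (vfM _ _ vZ) /bracket mulrBr addrA [E _ g * _]mulrC [c i * _ + _]addrC.
Qed.

Lemma ideal_KH X g : section H X -> J (bracket K X g).
Proof.
move=> sX; apply: germ_ideal_germ (bracket_comb_germ g vK (fun h => coefH h sX)) _.
apply: germ_ideal_sum => i; apply: germ_idealD.
  exact/germ_idealMr/ideal_K.
exact/germ_idealMl/ideal_KE.
Qed.

(* The coefficients of [X, [K, Y]] in the horizontal frame, modulo [J]. *)
Definition dcoef X Y i : cinfty M := X (coef (lshift m i) (bracket K Y)).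

(** Writing [K, Y] as the sum of c_i E_i, the terms c_i [X, E_i] lie in [J] because c_i does; the
    terms X(c_i) E_i remain. *)
Lemma bracket_bracket X Y g : section H X -> section H Y ->
  J (bracket X (bracket K Y) g - \sum_i dcoef X Y i * E (lshift m i) g).
Proof.
move=> sX sY.
have := bracket_comb_germ g sX.1 (fun h => coefH h (KH sY)).
set r := \sum_i _ => br; apply: (@germ_ideal_germ _ _ _ _ _ _ _ (r - _)).
  exact: germB br (germ_refl _ _).
rewrite /r -sumrB; apply: germ_ideal_sum => i.
rewrite addrAC subrr add0r; apply: germ_idealMr; apply: ideal_coef => h.
exact: ideal_KH.
Qed.

Lemma dcoef_sym X Y i : section H X -> section H Y -> J (dcoef X Y i - dcoef Y X i).
Proof.
move=> sX sY; have vX := sX.1; have vY := sY.1.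
pose W := bracket X Y; have vW : vector_field W by exact: vf_bracket.
pose Wh g := \sum_i coef (lshift m i) W * E (lshift m i) g.
pose Wv g := \sum_j coef (rshift k j) W * E (rshift k j) g.
have sWh : section H Wh by apply: section_comb => //; exact: horizontal_subbundle.
have sWv : section V Wv by apply: section_comb => //; exact: vertical_subbundle.
have WE g : germ_eq p (W g) (Wh g + Wv g).
  by have := coef_expand g vW; rewrite big_split_ord.
(* Since [K, Wh] lies in [J], the bracket [K, W] is modulo [J] the vertical field [K, Wv]. The
   family [c] collects the components modulo [J] of [X, [K, Y]] - [Y, [K, X]] - [K, Wv]. *)
pose w j := coef (rshift k j) (bracket K Wv).
pose c (a : 'I_N) := match fintype.split a with
  inl i => dcoef X Y i - dcoef Y X i | inr j => - w j end.
have cl i' : c (lshift m i') = dcoef X Y i' - dcoef Y X i'.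
  by rewrite /c (unsplitK (inl i')).
have cr j : c (rshift k j) = - w j by rewrite /c (unsplitK (inr j)).
have Jc g : J (\sum_a c a * E a g).
  have JXY := bracket_bracket g sX sY; have JYX := bracket_bracket g sY sX.
  have JWh := ideal_KH g sWh.
  have KWv := coefV g (KV sWv).
  have KW : germ_eq p (bracket K W g) (bracket K Wh g + bracket K Wv g).
    have := germB (vf_local vK (WE g)) (WE (K g)).
    suff -> : K (Wh g + Wv g) - (Wh (K g) + Wv (K g)) =
        bracket K Wh g + bracket K Wv g by [].
    by rewrite (vfD _ _ vK) opprD addrACA.
  have jac : bracket X (bracket K Y) g - bracket Y (bracket K X) g = bracket K W g.
    rewrite /W /bracket (vfB _ _ vX) (vfB _ _ vY) (vfB _ _ vK).
    exact: jacobi_identity.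
  have := germ_idealB (germ_idealB JWh JXY) (germ_idealN JYX).
  apply: germ_ideal_germ; rewrite big_split_ord /=.
  under eq_bigr do rewrite cl mulrBl.
  rewrite sumrB.
  under [X in _ + X]eq_bigr do rewrite cr mulNr.
  rewrite sumrN.
  move: KW KWv; rewrite -jac; apply: filterS2 => q + KWq.
  set b1 := bracket X _ g; set b2 := bracket Y _ g; set s1 := \sum_i _; set s2 := \sum_i _.
  rewrite -[X in X = _]/(b1 q - b2 q) -[X in _ = X]/(bracket K Wh g q + bracket K Wv g q).
  rewrite KWq => KWq'; set s3 := \sum_j _ in KWq' *.
  rewrite -[LHS]/(s1 q - s2 q - s3 q).
  rewrite -[RHS]/(bracket K Wh g q - (b1 q - s1 q) - - (b2 q - s2 q)).
  by lra.
have := germ_ideal_germ (germ_sym (coef_comb c (lshift m i))) _.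
rewrite cl; apply; apply: germ_ideal_sum => d; exact: germ_idealMr.
Qed.

Lemma innerc_K X Y : section H X -> section H Y ->
  K (innerc S X Y) = innerc S (bracket K X) Y + innerc S X (bracket K Y).
Proof.
move=> sX sY; apply: cinfty_eqP => q; case: KK => _ _ _ KS.
rewrite (KS X Y (innerc S X Y))// => [|q']; last exact: innercE.
by rewrite -[RHS]/(innerc S (bracket K X) Y q + innerc S X (bracket K Y) q)
  !innercE//; exact: KH.
Qed.

(* <[X, [K, Y]], Z> modulo [J]. *)
Definition dmetric X Y Z : cinfty M :=
  \sum_i dcoef X Y i * innerc S (E (lshift m i)) Z.

Lemma innerc_expand Y Z : section H Y -> section H Z ->
  germ_eq p (innerc S Y Z)
    (\sum_i coef (lshift m i) Y * innerc S (E (lshift m i)) Z).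
Proof.
move=> sY sZ; apply: filterS (coef_section (@lshift_inj _ _) bH sY) => q YE.
rewrite innercE// YE metric_suml; [|by move=> i; exact: (EH i).2|exact: sZ.2].
rewrite cinfty_sumE; apply: eq_bigr => i _.
by rewrite cinftyME innercE.
Qed.

Lemma ideal_dmetric X Y Z : section H X -> section H Y -> section H Z ->
  J (X (innerc S (bracket K Y) Z) - dmetric X Y Z).
Proof.
move=> sX sY sZ; have vX := sX.1.
have := vf_local vX (innerc_expand (KH sY) sZ).
move=> /germB/(_ (germ_refl p (dmetric X Y Z))); move/germ_ideal_germ; apply.
rewrite (vf_sum _ _ vX) -sumrB; apply: germ_ideal_sum => i.
rewrite (vfM _ _ vX) [_ * X (coef _ _)]mulrC addrK; apply: germ_idealMr.
by apply: ideal_coef => g; exact: ideal_KH.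
Qed.

Lemma ideal_XK X g : section H X -> J (X (K g)).
Proof.
move=> sX; have -> : X (K g) = K (X g) - bracket K X g.
  by rewrite /bracket opprB addrC subrK.
by apply: germ_idealB; [exact: ideal_K|exact: ideal_KH].
Qed.

(** X(K<Y, Z>) lies in [J]. The Killing equation splits K<Y, Z> into two pairings, whose derivatives
    along X are the two summands modulo [J]. *)
Lemma dmetric_skew X Y Z : section H X -> section H Y -> section H Z ->
  J (dmetric X Y Z + dmetric X Z Y).
Proof.
move=> sX sY sZ; have := ideal_XK (innerc S Y Z) sX.
rewrite innerc_K// (vfD _ _ sX.1) [innerc S Y _]innercC//; last exact: KH.
have J1 := ideal_dmetric sX sY sZ; have J2 := ideal_dmetric sX sZ sY.
move=> /germ_idealB/(_ (germ_idealD J1 J2)); congr J.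
by rewrite opprD !opprB addrACA ![X _ + _]addrC !subrK.
Qed.

Lemma dmetric_sym X Y Z : section H X -> section H Y ->
  J (dmetric X Y Z - dmetric Y X Z).
Proof.
move=> sX sY; rewrite -sumrB; apply: germ_ideal_sum => i.
by rewrite -mulrBl; apply: germ_idealMr; exact: dcoef_sym.
Qed.

(* A trilinear form symmetric in its first two arguments and skew in its last
   two vanishes. *)
Lemma dmetric0 X Y Z : section H X -> section H Y -> section H Z -> J (dmetric X Y Z).
Proof.
move=> sX sY sZ; apply: germ_ideal_half.
have e1 := dmetric_sym Z sX sY.
have e2 := dmetric_skew sY sX sZ.
have e3 := dmetric_sym X sY sZ.
have e4 := dmetric_skew sZ sY sX.
have e5 := dmetric_sym Y sZ sX.
have e6 := dmetric_skew sX sZ sY.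
rewrite (skew_sym_telescope (dmetric X Y Z) (dmetric Y X Z) (dmetric Y Z X)
  (dmetric Z Y X) (dmetric Z X Y) (dmetric X Z Y)).
apply: germ_idealD e6; apply: germ_idealD e5; apply: germ_idealB e4.
by apply: germ_idealB e3; exact: germ_idealD.
Qed.

(** The pairings [dmetric] with the frame are the coefficients multiplied by its Gram matrix. A
    kernel vector of that matrix at [p] gives a horizontal vector orthogonal to itself, so the
    matrix is invertible near [p] and the coefficients are recovered. *)
Lemma ideal_dcoef X Y i : section H X -> section H Y -> J (dcoef X Y i).
Proof.
move=> sX sY.
pose G : 'M[cinfty M]_k := \matrix_(i, j) innerc S (E (lshift m i)) (E (lshift m j)).
have Gp : map_mx (evalc p) G \in unitmx.
  rewrite -row_free_unit; apply: inj_row_free => v vG.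
  have [free HE] := nbhs_singleton bH.
  pose w := \sum_i v 0 i *: value_at (E (lshift m i)) p.
  have hw : H p w by rewrite HE; exists (v 0).
  have hE j : H p (value_at (E (lshift m j)) p) by exact: (EH j).2.
  have wE j : metric S p w (value_at (E (lshift m j)) p) = 0.
    rewrite metric_suml//; have /rowP/(_ j) := vG; rewrite !mxE => vGj.
    rewrite -[RHS]vGj.
    by apply: eq_bigr => l _; rewrite !mxE /evalc innercE.
  have w0 : w = 0.
    apply: contrapT => /eqP wn0; have := metric_pos hw wn0.
    rewrite metric_suml// big1 ?ltxx// => j _.
    by rewrite Defs.metric_sym// wE mulr0.
  by apply/rowP => j; rewrite mxE; exact: free.
have [G' GG'] := matrix_germ_inverse Gp.
apply: (@germ_ideal_germ _ _ _ _ _ _ _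
  (\sum_l dmetric X Y (E (lshift m l)) * G' l i)); last first.
  by apply: germ_ideal_sum => l; apply: germ_idealMr; exact: dmetric0.
apply: filterS GG' => q GG'; rewrite cinfty_sumE; apply/esym.
transitivity (\sum_l \sum_a dcoef X Y a q *
    (innerc S (E (lshift m a)) (E (lshift m l)) q * G' l i q)).
  apply: eq_bigr => l _; rewrite cinftyME cinfty_sumE mulr_suml.
  by apply: eq_bigr => a _; rewrite cinftyME mulrA.
rewrite exchange_big.
have GE a : \sum_l (innerc S (E (lshift m a)) (E (lshift m l)) q * G' l i q) = (a == i)%:R.
  have /matrixP/(_ a i) := GG'; rewrite !mxE => <-.
  by apply: eq_bigr => l _; rewrite !mxE.
rewrite (bigD1 i)//= [X in _ + X]big1 ?addr0 => [|a ai].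
  by rewrite -mulr_sumr GE eqxx mulr1.
by rewrite -mulr_sumr GE (negbTE ai) mulr0.
Qed.

(** By the Leibniz rule only generators matter. Expanding [K, E_i] in the horizontal frame, the
    coefficients lie in [J], and so do their derivatives along X, which are the [dcoef]. *)
Lemma ideal_horizontal X g : section H X -> J g -> J (X g).
Proof.
move=> sX; have vX := sX.1; apply: germ_ideal_vf => // -[c|[i c]] /=.
  exact: ideal_XK.
have := vf_local vX (coefH (f c) (KH (EH i))) => /germ_ideal_germ; apply.
rewrite (vf_sum _ _ vX); apply: germ_ideal_sum => l; rewrite (vfM _ _ vX).
apply: germ_idealD; last by apply: germ_idealMl; exact: ideal_dcoef.
by apply: germ_idealMr; apply: ideal_coef => g'; exact: ideal_KH.
Qed.

Lemma ideal_iterated Y g : iterated_bracket H Y -> J g -> J (Y g).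
Proof.
move=> bY; elim: bY g => [Z sZ g|Z W _ IHZ _ IHW g Jg]; first exact: ideal_horizontal.
by apply: germ_idealB; [exact/IHZ/IHW|exact/IHW/IHZ].
Qed.

End killing_ideal.

(** * Uniqueness for linear systems *)

Section linear_ode.
Context (R : realType) (I : finType).

(** A Cauchy-Schwarz inequality, obtained by summing ab <= (a^2 + b^2) / 2 over all pairs. *)
Lemma sum_norm_mul_le (x : I -> R) :
  (\sum_j `|x j|) * (\sum_j `|x j|) <= #|I|%:R * \sum_j x j ^+ 2.
Proof.
rewrite mulr_suml.
have -> : #|I|%:R * \sum_j x j ^+ 2 = \sum_i \sum_j (x i ^+ 2 + x j ^+ 2) / 2.
  under [RHS]eq_bigr => i _ do rewrite -mulr_suml big_split /= sumr_const.
  rewrite -mulr_suml big_split /= ?mulr1 sumrMnl sumr_const -mulr2n -[_ *+ 2]mulr_natr.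
  by rewrite mulfK ?pnatr_eq0// mulr_natl.
apply: ler_sum => i _; rewrite mulr_sumr; apply: ler_sum => j _.
rewrite ler_pdivlMr// -(real_normK (num_real (x i))) -(real_normK (num_real (x j))).
have := sqr_ge0 (`|x i| - `|x j|); set a := `|x i|; set b := `|x j|; rewrite !expr2; nra.
Qed.

(** Gronwall argument: the energy [W], damped by an exponential, is nonincreasing, nonnegative and 0
    at time 0. *)
Lemma linear_ode_uniq_ge0 (phi : I -> R -> R) (C t : R) : 0 <= C -> 0 <= t ->
  (forall s, 0 <= s <= t -> forall j, derivable (phi j) s 1 /\
     `|(phi j)^`()%classic s| <= C * \sum_l `|phi l s|) ->
  (forall j, phi j 0 = 0) -> forall j, phi j t = 0.
Proof.
move=> C0 t0 dphi phi0.
(* The derivative of [W] is at most 2 C times the square of the sum of the absolute values, and that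
   square is at most [#|I|] times [W]. *)
pose L := 2 * C * #|I|%:R.
pose W s := \sum_j phi j s ^+ 2.
pose F s := expR (- (L * s)) * W s.
pose dW s := \sum_j (2 * phi j s * (phi j)^`()%classic s).
have dF s : 0 <= s <= t -> is_derive s 1 F (expR (- (L * s)) * (dW s - L * W s)).
  move=> st.
  have dWs : is_derive s 1 W (dW s).
    rewrite /W /dW.
    have -> : (fun s => \sum_j phi j s ^+ 2) = \sum_j (phi j * phi j).
      by rewrite fct_sumE; apply/funext => s'; apply: eq_bigr => j _; rewrite expr2.
    elim/big_ind2: _ => [|f1 d1 f2 d2 ? ?|j _]; first exact: is_derive_cst.
      exact: is_deriveD.
    have [dj _] := dphi s st j; have Dj := derivableP dj.
    apply: (is_derive_eq (is_deriveM Dj Dj)).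
    by rewrite derive1E /GRing.scale/=; ring.
  have dL : is_derive s 1 (fun s => - (L * s)) (- L).
    have := is_deriveN (is_deriveZ L (is_derive_id s (1 : R))).
    by rewrite [_ *: 1]mulr1; apply.
  have dE : is_derive s 1 (fun s => expR (- (L * s))) (expR (- (L * s)) * - L).
    exact: (@is_derive1_comp _ (@expR R) (fun s => - (L * s))).
  apply: (is_derive_eq (is_deriveM dE dWs)).
  by rewrite /GRing.scale/=; ring.
have dF0 s : 0 <= s <= t -> F^`()%classic s <= 0.
  move=> st; have [_] := dF s st; rewrite -derive1E => ->.
  rewrite mulr_ge0_le0 ?expR_ge0// subr_le0 /dW /L.
  have Sb := sum_norm_mul_le (fun j => phi j s).
  rewrite -!mulrA; apply: le_trans
    (_ : 2 * (C * ((\sum_j `|phi j s|) * (\sum_j `|phi j s|))) <= _).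
    set s1 := \sum_l _; rewrite {1}/s1 mulr_suml 2!mulr_sumr; apply: ler_sum => j _.
    have [_ dj] := dphi s st j.
    rewrite -!mulrA ler_pM2l//; apply: le_trans (ler_norm _) _.
    by rewrite normrM [X in _ <= X]mulrCA; apply: ler_wpM2l.
  by rewrite ler_pM2l//; apply: ler_wpM2l.
have Ft : F t <= F 0.
  apply: (@ler0_derive1_le_cc _ F 0 t); rewrite ?in_itv/= ?lexx ?t0//.
  - by move=> s; rewrite in_itv/= => /andP[/ltW s0 /ltW st]; case: (dF s); rewrite ?s0.
  - by move=> s; rewrite in_itv/= => /andP[/ltW s0 /ltW st]; apply: dF0; rewrite s0.
  - apply: derivable_within_continuous => s; rewrite in_itv/= => st.
    by case: (dF s st).
have W0 : F 0 = 0 by rewrite /F /W big1 ?mulr0// => j _; rewrite phi0 expr0n.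
move: Ft; rewrite W0 /F pmulr_rle0 ?expR_gt0// => Wt j.
have : W t == 0 by rewrite eq_le Wt sumr_ge0// => i _; exact: sqr_ge0.
rewrite psumr_eq0 => [/allP/(_ j)|i _]; last exact: sqr_ge0.
by rewrite mem_index_enum sqrf_eq0 => /(_ isT)/eqP.
Qed.

(** The two conditions on [s] place it between 0 and [t] for either sign of [t]; negative [t] is
    reduced to positive time by reflection. *)
Lemma linear_ode_uniq (phi : I -> R -> R) (C t : R) : 0 <= C ->
  (forall s, `|s| <= `|t| -> 0 <= s * t -> forall j, derivable (phi j) s 1 /\
     `|(phi j)^`()%classic s| <= C * \sum_l `|phi l s|) ->
  (forall j, phi j 0 = 0) -> forall j, phi j t = 0.
Proof.
move=> C0 dphi phi0; have [t0|t0] := leP 0 t.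
  apply: (linear_ode_uniq_ge0 C0 t0) => // s /andP[s0 st].
  by apply: dphi; rewrite ?mulr_ge0// !ger0_norm.
move=> j; have t0' : 0 <= - t by rewrite oppr_ge0 ltW.
rewrite -[t]opprK.
apply: (@linear_ode_uniq_ge0 (fun j s => phi j (- s)) C (- t)) => // [s /andP[s0 st] i|i].
  have [||di bi] := dphi (- s) _ _ i.
  - by rewrite normrN -(normrN t) !ger0_norm.
  - by rewrite mulNr -mulrN mulr_ge0.
  have dN : is_derive s 1 (fun s => phi i (- s)) (- (phi i)^`()%classic (- s)).
    have := @is_derive1_comp _ (phi i) -%R s _ _ (derivableP di) (is_deriveNid s (1 : R)).
    by rewrite mulrN1 -derive1E.
  by split; [case: dN|rewrite derive1E (@derive_val _ _ _ _ _ _ _ dN) normrN].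
by rewrite oppr0.
Qed.
End linear_ode.

Section linear_pde.
Context (R : realType) (n : nat) (I : finType).

(* The point is reached from [x0] by moving along one coordinate axis at a time,
   so that only partial derivatives are involved. *)
Lemma linear_pde_uniq (x0 : 'rV[R]_n) (w : I -> 'rV[R]_n -> R)
    (G : 'I_n -> I -> I -> 'rV[R]_n -> R) :
  (\forall x \near x0, forall i j, derivable (w j) x (delta_mx 0 i) /\
     pderiv i (w j) x = \sum_l G i j l x * w l x) ->
  (forall i j l, {for x0, continuous (G i j l)}) ->
  (forall j, w j x0 = 0) -> \forall x \near x0, forall j, w j x = 0.
Proof.
move=> dw cG w0.
(* The margin 1 in each term makes the bound persist near [x0] by continuity. *)
pose C := \sum_(a : 'I_n * I * I) (`|G a.1.1 a.1.2 a.2 x0| + 1).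
have C0 : 0 <= C by apply: sumr_ge0 => a _; rewrite addr_ge0.
have GC : \forall x \near x0, forall a : 'I_n * I * I, `|G a.1.1 a.1.2 a.2 x| <= C.
  apply: (@filter_forall _ _ (fun (a : 'I_n * I * I) x => `|G a.1.1 a.1.2 a.2 x| <= C) _
    (nbhs_filter x0)) => a.
  have Ga := cvg_norm (cG a.1.1 a.1.2 a.2).
  have : `|G a.1.1 a.1.2 a.2 x0| < `|G a.1.1 a.1.2 a.2 x0| + 1 by rewrite ltrDl.
  move=> /(cvgr_lt _ (Ga _)); apply: filterS => x /ltW /le_trans; apply.
  by rewrite /C (bigD1 a)//= lerDl sumr_ge0// => b _; rewrite addr_ge0.
have [r /= r0 rP] := (nbhs_ballP _ _).1 (filterI dw GC).
apply: (nbhs_ballP _ _).2; exists r => // y [_ ry].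
(* Balls are products of intervals here, so the path from [x0] to [y] through the points [z s] stays
   in the ball. *)
pose z (s : nat) : 'rV[R]_n := \row_i (if (i < s)%N then y 0 i else x0 0 i).
suff wz s : (s <= n)%N -> forall j, w j (z s) = 0.
  move=> j; rewrite -(wz n (leqnn n) j); congr (w j _).
  by apply/rowP => i; rewrite mxE ltn_ord.
elim: s => [_ j|s IH sn].
  by rewrite -(w0 j); congr (w j _); apply/rowP => i; rewrite mxE.
have {}IH := IH (ltnW sn); pose i := Ordinal sn; pose t := y 0 i - x0 0 i.
have zS : z s.+1 = z s + t *: delta_mx 0 i.
  apply/rowP => a; rewrite !mxE eqxx /=; have [->|ai] := eqVneq a i.
    by rewrite /= ltnSn ltnn mulr1 /t addrC subrK.
  have as' : ((a : nat) == s) = false by apply: contra_neqF ai => /eqP ?; exact: val_inj.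
  by rewrite mulr0 addr0 ltnS leq_eqVlt as'.
move=> j; rewrite zS.
apply: (@linear_ode_uniq R I (fun j s' => w j (z s + s' *: delta_mx 0 i)) C t); last first.
- by move=> l; rewrite scale0r addr0.
- move=> s' s't s't0 l.
  set x := z s + s' *: delta_mx 0 i.
  have xr : ball x0 r x.
    split=> // a b; rewrite (ord1 a) /ball/= !mxE eqxx /=.
    have rb : `|x0 0 b - y 0 b| < r by have := ry 0 b.
    have [bi|bi] := eqVneq b i; last first.
      by rewrite mulr0 addr0; case: ifP => // _; rewrite subrr normr0.
    rewrite bi ltnn mulr1 opprD addrA subrr add0r normrN (le_lt_trans s't)//.
    by rewrite /t distrC -bi.
  have [dwx Gx] := rP x xr.
  have [dl El] := dwx i l.
  have dx := (is_derive_lineP (w l) (z s) (delta_mx 0 i) s' _).1 (derivableP dl).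
  split; first by case: dx.
  rewrite derive1E (@derive_val _ _ _ _ _ _ _ dx).
  rewrite -[X in `|X|]/(pderiv i (w l) x) El.
  apply: le_trans (ler_norm_sum _ _ _) _; rewrite mulr_sumr; apply: ler_sum => a _.
  by rewrite normrM ler_wpM2r//; exact: (Gx (i, l, a)).
- exact: C0.
Qed.
End linear_pde.

(** * From a stable germ ideal to a linear system in a chart *)

Section chart_derivatives.
Context (R : realType) (n : nat) (M : manifold R n).
Implicit Types (g h : cinfty M) (p q : M).

Lemma chart_derivable (c : chart R n M) g (x : 'rV[R]_n) (i : 'I_n) :
  atlas c -> cimg c x ->
  derivable (g \o cinv c) x (delta_mx 0 i).
Proof.
move=> ca cx; have /asboolP sg := cinftyP g.
by have [_ /(_ i)[dg _]] := sg c ca 1; exact: dg.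
Qed.

Lemma chart_pderiv_continuous (c : chart R n M) g (x : 'rV[R]_n) (i : 'I_n) :
  atlas c -> cimg c x ->
  {for x, continuous (pderiv i (g \o cinv c))}.
Proof.
move=> ca cx; have /asboolP sg := cinftyP g.
by have [_ /(_ i)[_ [cg _]]] := sg c ca 1; exact/cg/mem_set.
Qed.

Lemma chart_tangent (c : chart R n M) (x : 'rV[R]_n) (i : 'I_n) :
  atlas c -> cimg c x ->
  tangent (cinv c x) (fun g => pderiv i (g \o cinv c) x).
Proof.
move=> ca cx; have d g := derivableP (@chart_derivable c g x i ca cx).
split=> [a g h|g h].
  have D := is_deriveD (is_deriveZ a (d g)) (d h).
  exact: (@derive_val _ _ _ _ _ _ _ D).
have D := is_deriveM (d g) (d h).
exact: (@derive_val _ _ _ _ _ _ _ D).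
Qed.
End chart_derivatives.

Section vanishing.
Context (R : realType) (n k : nat) (M : manifold R n) (S : sub_riemannian k M).
Context (p : M) (I : finType) (u : I -> cinfty M).
Local Notation J := (germ_ideal p u).

(* The brackets that preserve the ideal span the tangent spaces near [p], so
   every derivative of [u] is a smooth combination of [u] itself. *)
Lemma germ_ideal_vanish N (E : 'I_N -> cinfty M -> cinfty M) (f : 'I_N -> cinfty M) :
  (forall a, vector_field (E a)) ->
  (forall a b, E a (f b) p = (a == b)%:R) ->
  (forall q, exists e : 'I_N -> (cinfty M -> R), forall v, tangent q v ->
     exists y : 'I_N -> R, v = \sum_a y a *: e a) ->
  (forall Y g, iterated_bracket (horizontal S) Y -> J g -> J (Y g)) ->
  (forall i, u i p = 0) -> \forall q \near p, forall i, u i q = 0.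
Proof.
move=> vE Ef span JY up.
(* Bracket generation is used at [p] alone: [E' a] is a constant-coefficient combination of iterated
   brackets equal to [E a] at [p]. It preserves [J], and duality with [f] at [p] makes the [E' a] a
   frame near [p]. *)
have /choice[E' E'P] : forall a, exists F : cinfty M -> cinfty M,
    [/\ vector_field F, forall g, J g -> J (F g) & forall g, F g p = E a g p].
  move=> a; have [d [c [Y [iY EY]]]] :=
    horizontal_bracket_generating S (vf_tangent p (vE a)).
  exists (fun g => \sum_i (c i *: (1 : cinfty M)) * Y i g); split.
  - by apply: vf_comb => i; exact/iterated_vf/iY.
  - by move=> g Jg; apply: germ_ideal_sum => i; apply: germ_idealMl; exact: JY.
  - move=> g; rewrite -[RHS]/(value_at (E a) p g) EY comb_apply cinfty_sumE.
    by apply: eq_bigr => i _; rewrite -[LHS]/(c i * 1 * Y i g p) mulr1.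
have vE' a : vector_field (E' a) by case: (E'P a).
have E'f a b : E' a (f b) p = (a == b)%:R by case: (E'P a) => _ _ ->.
have [B EB] := frame_expand vE' E'f span.
have /choice[A AE] : forall s : 'I_N * I, exists a : I -> cinfty M,
    germ_eq p (E' s.1 (u s.2)) (\sum_l a l * u l).
  by move=> [a j]; have [_ + _] := E'P a; apply; exact: germ_ideal_gen.
have {}AE : \forall q \near p, forall s, E' s.1 (u s.2) q = (\sum_l A s l * u l) q.
  exact: (@filter_forall _ _
    (fun s q => E' s.1 (u s.2) q = (\sum_l A s l * u l) q) _ (nbhs_filter p) AE).
have [c ca cp] := atlas_cover p.
set x0 := cmap c p; have x0c : cimg c x0 by exact: cmap_img.
have px0 : cinv c x0 = p by exact: cmapK.
have ci : cinv c @ x0 --> p.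
  have := @cinv_continuous _ _ _ c x0 (mem_set x0c).
  by rewrite /prop_for /continuous_at px0.
(* The inner sum is the component of the i-th coordinate vector along [E' a], and [A (a, j) l] is
   the coefficient of [u l] in [E' a (u j)]. *)
pose G (i : 'I_n) (j l : I) (x : 'rV[R]_n) : R :=
  \sum_a (\sum_b pderiv i (f b \o cinv c) x * B b a (cinv c x)) * A (a, j) l (cinv c x).
have cG i j l : {for x0, continuous (G i j l)}.
  have cc (g : cinfty M) : {for x0, continuous (fun x => g (cinv c x) : R)}.
    rewrite /prop_for /continuous_at px0; apply: cvg_comp ci _.
    exact: cinfty_continuous.

  apply: continuous_bigsum => a; apply: continuousM; last exact: cc.
  apply: continuous_bigsum => b; apply: continuousM; last exact: cc.
  exact: chart_pderiv_continuous.
have dw : \forall x \near x0, forall i j,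
    derivable (u j \o cinv c) x (delta_mx 0 i) /\
    pderiv i (u j \o cinv c) x = \sum_l G i j l x * (u l \o cinv c) x.
  have xc : \forall x \near x0, cimg c x.
    exact: (open_nbhs_nbhs (conj (cimg_open (c := c)) x0c)).
  have pull (P : set M) : nbhs p P -> nbhs x0 (cinv c @^-1` P) by exact: ci.
  apply: filterS (filterI xc (filterI (pull _ EB) (pull _ AE))).
  move=> x [{}xc [[_ Ex] Ax]] i j.
  split; first exact: chart_derivable.
  rewrite (Ex _ (chart_tangent i ca xc)) /G.
  transitivity (\sum_a \sum_l (\sum_b pderiv i (f b \o cinv c) x * B b a (cinv c x)) *
     A (a, j) l (cinv c x) * u l (cinv c x)).
    apply: eq_bigr => a _; rewrite (Ax (a, j)) cinfty_sumE mulr_sumr.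
    by apply: eq_bigr => l _; rewrite cinftyME mulrA.
  by rewrite exchange_big; apply: eq_bigr => l _; rewrite mulr_suml.
have w0 j : (u j \o cinv c) x0 = 0 by rewrite /= px0.
have wu := linear_pde_uniq dw cG w0.
have pd : \forall m \near p, cdom c m by exact: (open_nbhs_nbhs (conj (cdom_open c) cp)).
have cx := @cmap_continuous _ _ _ c p (mem_set cp).
have pull (P : set 'rV[R]_n) : nbhs x0 P -> nbhs p (cmap c @^-1` P) by exact: cx.
apply: filterS (filterI pd (pull _ wu)) => q [qd wq] i.
by have := wq i; rewrite /= cmapK.
Qed.
End vanishing.

(** * Bounding a dimension by separating functionals *)

Section dimension.
Context (R : realType) (V : lmodType R).

(** Induction on the number of functionals, as [V] may be infinite-dimensional. If the first one is
    0 on [P], it is dropped; otherwise [P] is the sum of its kernel in [P] and the line of some [e]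
    where it is nonzero. *)
Lemma has_dim_le_functionals (I : finType) (P : set V) (lam : I -> V -> R) :
  P 0 -> (forall a x y, P x -> P y -> P (a *: x + y)) ->
  (forall i a x y, P x -> P y -> lam i (a *: x + y) = a * lam i x + lam i y) ->
  (forall x, P x -> (forall i, lam i x = 0) -> x = 0) ->
  exists2 d : nat, has_dim P d & (d <= #|I|)%N.
Proof.
suff main N : forall (P : set V) (mu : 'I_N -> V -> R),
    P 0 -> (forall a x y, P x -> P y -> P (a *: x + y)) ->
    (forall i a x y, P x -> P y -> mu i (a *: x + y) = a * mu i x + mu i y) ->
    (forall x, P x -> (forall i, mu i x = 0) -> x = 0) ->
    exists2 d : nat, has_dim P d & (d <= N)%N.
  move=> P0 PL lamL inj; apply: (main #|I| P (fun i => lam (enum_val i))) => //.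
  - by move=> i; exact: lamL.
  - by move=> x Px lx; apply: inj => // i; rewrite -(enum_rankK i).
elim: N => [|N IH] {}P mu P0 PL muL inj.
  exists 0%N => //; exists (fun=> 0); split; first by move=> c _ [].
  rewrite predeqE => x; split=> [Px|[c ->]]; last by rewrite big_ord0.
  by exists (fun=> 0); rewrite big_ord0; apply: inj => // -[].
have [[e Pe mue]|nmu] := pselect (exists2 e, P e & mu ord0 e != 0); last first.
  have [||||d Pd dN] := IH P (fun i => mu (lift ord0 i)) => //.
  - by move=> i; exact: muL.
  - move=> x Px mux; apply: inj => // i; case: (unliftP ord0 i) => [j|] -> //.
    by apply: contrapT => /eqP nx; apply: nmu; exists x.
  - by exists d => //; exact: leqW.
have mu0 i : mu i 0 = 0.
  by have := muL i (-1) 0 0 P0 P0; rewrite scaler0 addr0 mulN1r addNr.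
have PZ a x : P x -> P (a *: x) by move=> Px; rewrite -[_ *: _]addr0; exact: PL.
have muZ i a x : P x -> mu i (a *: x) = a * mu i x.
  by move=> Px; have := muL i a x 0 Px P0; rewrite mu0 !addr0.
pose Q := [set x | P x /\ mu ord0 x = 0].
have [||||d [b [free QE]] dN] := IH Q (fun i => mu (lift ord0 i)).
- by split.
- by move=> a x y [Px x0] [Py y0]; split; [exact: PL|rewrite muL// x0 y0 mulr0 addr0].
- by move=> i a x y [Px _] [Py _]; exact: muL.
- by move=> x [Px x0] mux; apply: inj => // i; case: (unliftP ord0 i) => [j|] ->.
exists d.+1 => //.
exists (fun i => if unlift ord0 i is Some j then b j else e); split.
  move=> c; rewrite big_ord_recl unlift_none.
  under eq_bigr => i _ do rewrite liftK.
  set s := \sum_i _ => ce.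
  have [Ps s0] : Q s by rewrite QE; exists (fun i => c (lift ord0 i)).
  have c0 : c ord0 = 0.
    have := muL ord0 (c ord0) e s Pe Ps; rewrite ce mu0 s0 addr0 => /esym/eqP.
    by rewrite mulf_eq0 (negbTE mue) orbF => /eqP.
  move: ce; rewrite c0 scale0r add0r => /free cl i.
  by case: (unliftP ord0 i) => [j|] ->.
rewrite predeqE => x; split=> [Px|[c ->]].
  pose a := mu ord0 x / mu ord0 e.
  have : Q (- a *: e + x).
    split; first exact: PL.
    by rewrite muL// mulNr /a divfK// addNr.
  rewrite QE => -[c cE].
  exists (fun i => if unlift ord0 i is Some j then c j else a).
  rewrite big_ord_recl unlift_none.
  under eq_bigr => i _ do rewrite liftK.
  by rewrite -cE scaleNr addrA subrr add0r.
rewrite big_ord_recl unlift_none.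
under eq_bigr => i _ do rewrite liftK.
apply: PL => //.
by have [] : Q (\sum_i c (lift ord0 i) *: b i) by rewrite QE; eexists.
Qed.
End dimension.

(** * Killing fields *)

Section killing_fields.
Context (R : realType) (n k m : nat) (M : manifold R n) (S : sRC_structure k m M).
Local Notation N := (k + m)%N.
Local Notation H := (horizontal S).
Local Notation V := (vertical S).
Implicit Types (g h : cinfty M) (p q : M) (K L X Y : cinfty M -> cinfty M).

Let sH : subbundle k H := horizontal_subbundle S.
Let sV : subbundle m V := vertical_subbundle S.

Lemma tangent_span q : exists e : 'I_N -> (cinfty M -> R),
  forall v, tangent q v -> exists y : 'I_N -> R, v = \sum_a y a *: e a.
Proof.
have [e1 [_ He]] := subbundle_basis sH q.
have [e2 [_ Ve]] := subbundle_basis sV q.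
exists (fun a => match fintype.split a with inl i => e1 i | inr j => e2 j end) => v.
move=> /(tangent_direct_sum S)[[h w] [[/= + + ->] _]]; rewrite He Ve => -[c ->] [d ->].
exists (fun a => match fintype.split a with inl i => c i | inr j => d j end).
rewrite big_split_ord; congr (_ + _); apply: eq_bigr => i _.
  by rewrite (unsplitK (inl i)).
by rewrite (unsplitK (inr i)).
Qed.

Lemma adapted_frame p : exists (E : 'I_N -> cinfty M -> cinfty M)
    (f : 'I_N -> cinfty M) (B : 'M[cinfty M]_N),
  [/\ (forall i, section H (E (lshift m i))) /\ (forall j, section V (E (rshift k j))),
      \forall q \near p, is_basis (H q) (fun i => value_at (E (lshift m i)) q),
      \forall q \near p, is_basis (V q) (fun j => value_at (E (rshift k j)) q),
      forall a b, E a (f b) p = (a == b)%:R &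
      \forall q \near p,
        (forall a b, \sum_c E a (f c) q * B c b q = (a == b)%:R) /\
        (forall v, tangent q v -> forall g,
          v g = \sum_a (\sum_c v (f c) * B c a q) * E a g q)].
Proof.
have [X [XH bX]] := subbundle_frame sH p.
have [Y [YV bY]] := subbundle_frame sV p.
pose E (a : 'I_N) := match fintype.split a with inl i => X i | inr j => Y j end.
have El i : E (lshift m i) = X i by rewrite /E (unsplitK (inl i)).
have Er j : E (rshift k j) = Y j by rewrite /E (unsplitK (inr j)).
have vE a : vector_field (E a).
  by case: (split_ordP a) => i ->; rewrite ?El ?Er; [case: (XH i)|case: (YV i)].
(* Duality requires independence at [p]. A linear relation splits 0 into a horizontal and a vertical
   part, and uniqueness of the decomposition of 0 makes both parts 0. *)
have [f Ef] : exists f : 'I_N -> cinfty M, forall a b, E a (f b) p = (a == b)%:R.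
  apply: (@dual_family _ _ N (fun a g => E a g p)) => [a c x y|c cE].
    by rewrite (vE a).1.
  have [fX HE] := nbhs_singleton bX; have [fY VE] := nbhs_singleton bY.
  pose h := \sum_i c (lshift m i) *: value_at (X i) p.
  pose w := \sum_j c (rshift k j) *: value_at (Y j) p.
  have hw0 : 0 = h + w.
    apply/funext => g; rewrite -[LHS](cE g) big_split_ord /=.
    rewrite -[RHS]/(h g + w g) /h /w !comb_apply; congr (_ + _); apply: eq_bigr => i _.
      by rewrite El.
    by rewrite Er.
  have t0 : tangent p (0 : cinfty M -> R).
    by split=> *; rewrite -![(0 : cinfty M -> R) _]/(0 : R) !mulr0 addr0.
  have [[h' w'] [_ uniq]] := tangent_direct_sum S t0.
  have e1 : (h', w') = (h, w).
    apply: uniq; split => //=; first by rewrite HE; exists (fun i => c (lshift m i)).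
    by rewrite VE; exists (fun j => c (rshift k j)).
  have [h0 w0] : (h, w) = (0, 0).
    rewrite -e1; apply: uniq; split; rewrite /= ?addr0//; exact: subbundle0.
  move=> a; case: (split_ordP a) => i ->; first exact: (fX _ h0).
  exact: (fY _ w0).
have [B EB] := frame_expand vE Ef tangent_span.
exists E, f, B; split => //.
- by split=> i; rewrite ?El ?Er.
- by move: bX; apply: filterS => q; congr is_basis; apply/funext => i; rewrite El.
- by move: bY; apply: filterS => q; congr is_basis; apply/funext => i; rewrite Er.
Qed.

Lemma killing_vanish_near K p : H_Killing S K -> (forall g, K g p = 0) ->
  (forall X g, section H X -> bracket K X g p = 0) ->
  \forall q \near p, forall g, K g q = 0.
Proof.
move=> KK Kp KXp; have [E [f [B [[EH EV] bH bV Ef EB]]]] := adapted_frame p.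
have vE a : vector_field (E a).
  by case: (split_ordP a) => i ->; [case: (EH i)|case: (EV i)].
have vK : vector_field K by case: KK.
have JY Y g := @ideal_iterated _ _ _ _ _ S p E f B EH EV bH bV EB K KK Y g.
have up s : killing_gen E f K s p = 0 by case: s => [c|[i c]] /=; [|exact: KXp].
have := germ_ideal_vanish vE Ef tangent_span JY up.
move=> u0; apply: filterS (filterI EB u0) => q [[_ EBq] uq] g.
have := EBq _ (vf_tangent q vK) g; rewrite /value_at => ->.
rewrite big1// => a _; rewrite big1 ?mul0r// => c _.
by rewrite (uq (inl c)) mul0r.
Qed.

(** The set of points near which K vanishes is open and nonempty. It is closed because K g and
    [K, X] g are continuous, so both vanish at a limit point, where [killing_vanish_near] applies
    again. *)
Lemma killing_unique_continuation K p : connected [set: M] -> H_Killing S K ->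
  (forall g, K g p = 0) -> (forall X g, section H X -> bracket K X g p = 0) -> K = 0.
Proof.
move=> cM KK Kp KXp.
pose Z : set M := [set q | \forall q' \near q, forall g, K g q' = 0].
suff ZT : Z = [set: M].
  apply/funext => g; apply: cinfty_eqP => q.
  by have : Z q by [rewrite ZT]; move=> /nbhs_singleton /(_ g).
have vK : vector_field K by case: KK.
apply: cM.
- by exists p; exact: killing_vanish_near.
- exists Z; last by rewrite setTI.
  by rewrite openE => q; exact: nbhs_interior.
exists Z; last by rewrite setTI.
have closed_zero g (W : set M) : (forall q, W q -> g q = 0) ->
    forall q, closure W q -> g q = 0.
  move=> Wg q Wq; apply: contrapT => /eqP gq.
  have : nbhs q [set q' | g q' != 0].
    exact: (cinfty_continuous (open_nbhs_nbhs (conj (@open_neq _ 0) gq))).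
  by move=> /Wq[q' [/Wg gq' /=]]; rewrite gq' eqxx.
move=> q Zq; apply: killing_vanish_near => // [g|X g sX].
  by apply: closed_zero Zq => q' /nbhs_singleton.
apply: closed_zero Zq => q' Zq'.
have Kg0 : germ_eq q' (K g) 0 by apply: filterS Zq' => q'' /(_ g).
have := nbhs_singleton (vf_local sX.1 Kg0); rewrite (vf0 sX.1) => XK.
by rewrite -[LHS]/(K (X g) q' - X (K g) q') XK (nbhs_singleton Zq') subrr.
Qed.

(** * The H-Killing fields form a linear subspace; the dimension bound *)

Lemma bracket_linl a K L X : vector_field X ->
  bracket (a *: K + L) X = a *: bracket K X + bracket L X.
Proof.
move=> vX; apply/funext => g.
rewrite /bracket -[RHS]/(a *: (K (X g) - X (K g)) + (L (X g) - X (L g))).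
rewrite -[LHS]/(a *: K (X g) + L (X g) - X (a *: K g + L g)) vX.1.
by rewrite scalerBr opprD addrACA.
Qed.

Lemma bracket0l X : vector_field X -> bracket 0 X = 0.
Proof.
move=> vX; apply/funext => g.
by rewrite /bracket -[LHS]/(0 - X 0) (vf0 vX) subr0.
Qed.

Lemma vector_field_lin a K L : vector_field K -> vector_field L ->
  vector_field (a *: K + L).
Proof.
move=> vK vL; have E g : (a *: K + L) g = a *: K g + L g by [].
split=> [b g h|g h]; rewrite !E.
  rewrite vK.1 vL.1 !scalerDr !scalerA mulrC.
  by rewrite -!addrA; congr (_ + _); rewrite addrCA.
rewrite (vfM _ _ vK) (vfM _ _ vL) scalerDr !cinfty_scalerAr !mulrDr.
by rewrite addrACA.
Qed.

Lemma vector_field0 : vector_field (0 : cinfty M -> cinfty M).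
Proof.
by split=> *;
  rewrite -![(0 : cinfty M -> cinfty M) _]/(0 : cinfty M) ?scaler0 ?mulr0 addr0.
Qed.

Lemma section_lin r (D : M -> set (cinfty M -> R)) a X Y : subbundle r D ->
  section D X -> section D Y -> section D (a *: X + Y).
Proof.
move=> sD [vX DX] [vY DY]; split; first exact: vector_field_lin.
by move=> q; exact: (subbundle_lin sD a (DX q) (DY q)).
Qed.

Lemma section0 r (D : M -> set (cinfty M -> R)) : subbundle r D ->
  section D (0 : cinfty M -> cinfty M).
Proof. by move=> sD; split; [exact: vector_field0|move=> q; exact: (subbundle0 sD q)]. Qed.

Lemma inner_linl a X Y Z q : section H X -> section H Y -> section H Z ->
  inner S (a *: X + Y) Z q = a * inner S X Z q + inner S Y Z q.
Proof.
by move=> [_ HX] [_ HY] [_ HZ]; exact: (metric_linear a (HX q) (HY q) (HZ q)).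
Qed.

Lemma inner_sym X Y q : section H X -> section H Y -> inner S X Y q = inner S Y X q.
Proof. by move=> [_ HX] [_ HY]; exact: Defs.metric_sym. Qed.

Lemma H_Killing_lin a K L : H_Killing S K -> H_Killing S L -> H_Killing S (a *: K + L).
Proof.
move=> [vK KH KV KS] [vL LH LV LS]; split.
- exact: vector_field_lin.
- move=> X sX; rewrite (bracket_linl _ _ _ sX.1).
  by apply: section_lin => //; [exact: KH|exact: LH].
- move=> X sX; rewrite (bracket_linl _ _ _ sX.1).
  by apply: section_lin => //; [exact: KV|exact: LV].
move=> X Y h sX sY hE q; have [KX KY] := (KH X sX, KH Y sY).
have [LX LY] := (LH X sX, LH Y sY).
rewrite -[LHS]/(a * K h q + L h q) (KS X Y h)// (LS X Y h)//.
rewrite (bracket_linl _ _ _ sX.1) (bracket_linl _ _ _ sY.1) inner_linl//.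
rewrite (inner_sym q sX (section_lin a sH KY LY)) inner_linl//.
by rewrite (inner_sym q KY sX) (inner_sym q LY sX) mulrDr addrACA.
Qed.

Lemma H_Killing0 : H_Killing S 0.
Proof.
split; first exact: vector_field0.
- by move=> X sX; rewrite (bracket0l sX.1); exact: section0 sH.
- by move=> X sX; rewrite (bracket0l sX.1); exact: section0 sV.
move=> X Y h sX sY _ q; rewrite (bracket0l sX.1) (bracket0l sY.1).
rewrite (inner_sym q sX (section0 sH)).
by rewrite /inner !metric0l ?addr0//; [exact: sX.2|exact: sY.2].
Qed.

Lemma killing_has_dim : connected [set: M] ->
  exists2 d : nat, has_dim (H_Killing S) d & (d <= k + m + 'C(k, 2))%N.
Proof.
(* Over an empty manifold every field is 0, and the empty family of functionals separates. *)
move=> cM; have [[p _]|M0] := pselect (exists p : M, True); last first.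
  have [||||d Pd d0] := @has_dim_le_functionals R _ void (H_Killing S) (fun _ _ => 0).
  - exact: H_Killing0.
  - by move=> a K L; exact: H_Killing_lin.
  - by case.
  - move=> K _ _; apply/funext => g; apply: cinfty_eqP => q.
    by case: M0; exists q.
  by exists d => //; rewrite (leq_trans d0)// card_void.
have [E [f [B [[EH EV] bH bV Ef EB]]]] := adapted_frame p.
pose X i := E (lshift m i).
pose alpha K i j := inner S (bracket K (X i)) (X j) p.
pose wd (j : 'I_k) (i : 'I_j) : 'I_k := widen_ord (ltnW (ltn_ord j)) i.
(* The right summand encodes the pairs i < j, that is, the entries of a skew matrix above the
   diagonal. *)
pose I : finType := ('I_N + {j : 'I_k & 'I_j})%type.
pose lam (s : I) K : R := match s with
  | inl a => K (f a) p
  | inr s => alpha K (wd (tag s) (tagged s)) (tag s)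
  end.
have cardI : #|I| = (k + m + 'C(k, 2))%N.
  rewrite card_sum card_ord card_tagged; congr (_ + _)%N.
  rewrite -bin2_sum big_mkord sumnE big_map big_enum /=.
  by apply: eq_bigr => j _; rewrite card_ord.
rewrite -cardI; apply: (@has_dim_le_functionals R _ I (H_Killing S) lam).
- exact: H_Killing0.
- by move=> a K L; exact: H_Killing_lin.
- move=> [b|s] a K L [_ KH _ _] [_ LH _ _] //=.
  rewrite /alpha (bracket_linl _ _ _ (EH _).1) inner_linl//.
  + exact/KH/EH.
  + exact/LH/EH.
  + exact: EH.
move=> K KK lam0; have [vK KH _ KS] := KK.
have Kp g : K g p = 0.
  have [_ EBp] := nbhs_singleton EB.
  have := EBp _ (vf_tangent p vK) g; rewrite /value_at => ->.
  rewrite big1// => a _; rewrite big1 ?mul0r// => c _.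
  by have /= -> := lam0 (inl c); rewrite mul0r.
(* As K is 0 at [p], it annihilates <X_i, X_j> there, and the Killing equation becomes
   skew-symmetry. *)
have alpha_skew i j : alpha K i j + alpha K j i = 0.
  have [h hE] := inner_cinfty (EH i) (EH j).
  have := KS _ _ h (EH i) (EH j) hE p; rewrite Kp => ->.
  by rewrite /alpha (inner_sym p (KH _ (EH j)) (EH i)).
have alpha0 i j : alpha K i j = 0.
  have alt (i' j' : 'I_k) : (i' < j')%N -> alpha K i' j' = 0.
    move=> ij; have /= := lam0 (inr (Tagged (fun j : 'I_k => 'I_j) (Ordinal ij))).
    by congr (alpha K _ _ = 0); exact: val_inj.
  have [ij|ji|/val_inj ->] := ltngtP i j; first exact: alt.
    by have := alpha_skew j i; rewrite (alt _ _ ji) add0r.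
  by have := alpha_skew j j; rewrite -mulr2n => /eqP; rewrite mulrn_eq0 => /eqP.
have KXi i : value_at (bracket K (X i)) p = 0.
  apply: contrapT => /eqP vn0; set v := value_at _ p in vn0.
  have hv : H p v by exact: (KH _ (EH i)).2.
  have := metric_pos hv vn0.
  have [_ Hp] := nbhs_singleton bH.
  have [c vE] : exists c : 'I_k -> R, v = \sum_j c j *: value_at (X j) p.
    by move: (hv); rewrite Hp.
  rewrite {1}vE metric_suml => [|j|//]; last exact: (EH j).2.
  rewrite big1 ?ltxx// => j _; have hj : H p (value_at (X j) p) by exact: (EH j).2.
  by rewrite Defs.metric_sym// -[metric _ _ _ _]/(alpha K i j) alpha0 mulr0.
apply: (@killing_unique_continuation K p) => // Y g sY.
(* For an arbitrary horizontal [Y], the frame expansion of [K, Y] at [p] involves only K(c_i) and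
   [K, X_i], which are 0 there. *)
have := bracket_comb_germ g vK (fun h => coefH bH EB h sY).
move=> /nbhs_singleton ->; rewrite cinfty_sumE big1// => i _.
set c := coef _ _ _ _.
rewrite -[LHS]/(K c p * E (lshift m i) g p + c p * value_at (bracket K (X i)) p g).
by rewrite Kp KXi mul0r add0r mulr0.
Qed.
End killing_fields.

Lemma triangular_succ k : (k + (k * (k - 1)) %/ 2 = (k * (k + 1)) %/ 2)%N.
Proof. by rewrite -divnMDl//; congr (_ %/ _)%N; case: k => // k; lia. Qed.

Theorem corollary3p12 (R : realType) (n k m : nat) (M : manifold R n)
    (S : sRC_structure k m M)
    (hconn : connected [set: M]) (hcompl : sr_complete S) :
  (exists2 d : nat, has_dim (H_Killing S) d
     & (d <= m + k + (k * (k - 1)) %/ 2)%N) /\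
  (m + k + (k * (k - 1)) %/ 2 = m + (k * (k + 1)) %/ 2)%N.
Proof.
have bin2E : ((k * (k - 1)) %/ 2 = 'C(k, 2))%N by rewrite bin2 subn1 divn2.
split.
  have [d dK dle] := killing_has_dim S hconn.
  by exists d; rewrite // bin2E [(m + k)%N]addnC.
by rewrite -addnA triangular_succ.
Qed.
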